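(* Let $T$ be a complete theory with monster model $\mathfrak C$, let $G$ be a subgroup with $\mathrm{Autf}_L(\mathfrak C)\subseteq G\le\mathrm{Aut}(\mathfrak C)$, and let $\overline{\overline{G}}=j^{-1}[\mathrm{cl}(j[G])]$, where $j:\mathrm{Aut}(\mathfrak C)\to\mathrm{Gal}_L(T)$ is the quotient map and $\mathrm{cl}$ denotes closure in $\mathrm{Gal}_L(T)$. Then: (i) On each sort of $\mathfrak C$, $E_{\overline{\overline{G}}}$ is the finest bounded equivalence relation which is $\bigwedge$-definable over a small model and extends $E_G$; that is, $E_{\overline{\overline G}}$ is such a relation, and whenever $E$ is an equivalence relation $\bigwedge$-definable over some small model with $E_G\subseteq E$, then $E_{\overline{\overline G}}\subseteq E$. (ii) If additionally $G\lhd \mathrm{Aut}(\mathfrak C)$, then $E_{\overline{\overline{G}}}=\Theta\circ\overline{E_G}$, where $\overline{E_G}$ is the closure of $E_G$ in $S_{k+k}(\emptyset)$ (on $k$-tuples), and $(\Theta\circ\overline{E_G})(a,b)$ means that there is $c$ with $\Theta(a,c)$ and $\overline{E_G}(c,b)$.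
   Context: $T$ is a complete first-order theory, $\mathfrak C$ a monster model; small models are $M\prec\mathfrak C$ with $|M|=|T|$, small tuples have length $\le|T|$. $\mathrm{Autf}_L(\mathfrak C)$ is the subgroup of $\mathrm{Aut}(\mathfrak C)$ generated by all $\mathrm{Aut}(\mathfrak C/M)$ for small models $M$; $\mathrm{Gal}_L(T)=\mathrm{Aut}(\mathfrak C)/\mathrm{Autf}_L(\mathfrak C)$ with the following compact group topology: for small models $M,N$, $S_M(N)=\{\mathrm{tp}(M'/N):\mathrm{tp}(M')=\mathrm{tp}(M)\}$ with the type-space topology, $\mu(f)=\mathrm{tp}(f(M)/N)$, $\nu:S_M(N)\to\mathrm{Gal}_L(T)$ with $j=\nu\circ\mu$, and $Y$ closed iff $\nu^{-1}[Y]$ closed. For $H\le \mathrm{Aut}(\mathfrak C)$, $E_H(a,b)$ iff $a=f(b)$ for some $f\in H$ (on small tuples of any sort). A $\emptyset$-invariant relation on $k$-tuples is identified with a subset of $S_{k+k}(\emptyset)$. A formula $\varphi(x,y)$ over $\emptyset$ (with $|x|=|y|=k$), symmetric, is thick if for some $n<\omega$ every sequence $(a_i)_{i<n}$ has $i<j<n$ with $\varphi(a_i,a_j)$; $\Theta(x,y)$ is the conjunction of all thick formulas. Bounded means having boundedly many classes; $\bigwedge$-definable means type-definable. *)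

(* Defs.v *)
From HB Require Import structures.
From mathcomp Require Import all_boot generic_quotient.
From mathcomp Require Import all_classical topology.

Set Implicit Arguments.
Unset Strict Implicit.
Unset Printing Implicit Defensive.

Local Open Scope classical_set_scope.
Local Open Scope card_scope.
Local Open Scope group_scope.

Definition card_lt {A B : Type} (X : set A) (Y : set B) : Prop :=
  X #<= Y /\ ~ (Y #<= X).

Record language := Language {
  lsort : Type;
  fsym : Type;
  fsize : fsym -> nat;
  farg : forall f : fsym, 'I_(fsize f) -> lsort;
  fres : fsym -> lsort;
  rsym : Type;
  rsize : rsym -> nat;
  rarg : forall r : rsym, 'I_(rsize r) -> lsort
}.

(* A context is a possibly infinite tuple of sorted variables.  It plays the
   role of the sort (or length) k of the k-tuples. *)
Record ctx (L : language) := Ctx { cvar :> Type; csort : cvar -> lsort L }.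

Section Syntax.
Variable L : language.

Definition ctx0 : ctx L := Ctx (fun v : void => of_void (lsort L) v).

Definition ctx_cat (V W : ctx L) : ctx L :=
  Ctx (fun v : V + W => match v with inl x => csort x | inr y => csort y end).

Definition ctx_snoc (V : ctx L) (s : lsort L) : ctx L :=
  Ctx (fun v : option V => match v with Some x => csort x | None => s end).

Inductive term (V : ctx L) : lsort L -> Type :=
| Var (v : V) : term V (csort v)
| App (f : fsym L) (t : forall i : 'I_(fsize f), term V (farg i)) :
    term V (fres f).

(* In [All s p] the bound variable is the variable [None] of [p]. *)
Inductive formula (V : ctx L) : Type :=
| Equ (s : lsort L) (t u : term V s)
| Rel (r : rsym L) (t : forall i : 'I_(rsize r), term V (rarg i))
| Bot
| Imp (p q : formula V)
| All (s : lsort L) (p : formula (ctx_snoc V s)).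

Definition Neg (V : ctx L) (p : formula V) : formula V := Imp p (Bot V).

Definition sentence := formula ctx0.

(* The formulas in variables x_0, ..., x_{n-1}: a set of size |L| + aleph_0,
   which is |T| for every L-theory T. *)
Definition all_formulas :=
  {n : nat & {s : 'I_n -> lsort L & formula (Ctx s)}}.

End Syntax.

Record structure (L : language) := Structure {
  car :> lsort L -> Type;
  car_inhabited : forall s, inhabited (car s);
  fint : forall f : fsym L,
    (forall i : 'I_(fsize f), car (farg i)) -> car (fres f);
  rint : forall r : rsym L, (forall i : 'I_(rsize r), car (rarg i)) -> Prop
}.
Arguments fint {L} _ f _.
Arguments rint {L} _ r _.

Definition tup L (V : ctx L) (C : structure L) := forall v : V, C (csort v).

Section Semantics.
Variables (L : language) (C : structure L).

Definition tup0 : tup (ctx0 L) C := fun v : void => match v with end.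

Definition tcat (V W : ctx L) (a : tup V C) (b : tup W C) :
    tup (ctx_cat V W) C :=
  fun v => match v with inl x => a x | inr y => b y end.

Definition tsnoc (V : ctx L) (s : lsort L) (a : tup V C) (x : C s) :
    tup (ctx_snoc V s) C :=
  fun v => match v with Some y => a y | None => x end.

Fixpoint eval (V : ctx L) (a : tup V C) (s : lsort L) (t : term V s) : C s :=
  match t with
  | Var v => a v
  | App f u => fint C f (fun i => eval a (u i))
  end.

Fixpoint sat (V : ctx L) (p : formula V) : tup V C -> Prop :=
  match p with
  | Equ s t u => fun a => eval a t = eval a u
  | Rel r t => fun a => rint C r (fun i => eval a (t i))
  | Bot => fun _ => False
  | Imp p q => fun a => sat p a -> sat q a
  | All s p => fun a => forall x : C s, sat p (tsnoc a x)
  end.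

Lemma sat_Imp (V : ctx L) (p q : formula V) (a : tup V C) :
  sat (Imp p q) a = (sat p a -> sat q a).
Proof. by []. Qed.

Lemma sat_Neg (V : ctx L) (p : formula V) (a : tup V C) :
  sat (Neg p) a = ~ sat p a.
Proof. by []. Qed.

Definition models (T : set (sentence L)) : Prop :=
  forall p, T p -> sat p tup0.

End Semantics.

Definition entails L (T : set (sentence L)) (p : sentence L) : Prop :=
  forall M : structure L, models M T -> sat p (tup0 M).

Definition complete_theory L (T : set (sentence L)) : Prop :=
  (exists M : structure L, models M T) /\
  forall p, entails T p \/ entails T (Neg p).

(* Complete types over the empty set in the variables V; for C a model of the
   complete theory T, consistent with T means finitely satisfiable in C.
   The basic open sets are the {q | p \in q} for p a formula. *)

Record stype L (C : structure L) (V : ctx L) := SType {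
  in_type : set (formula V);
  stype_sat : forall F : set (formula V), finite_set F -> F `<=` in_type ->
    exists a : tup V C, forall p, F p -> sat p a;
  stype_complete : forall p, in_type p \/ in_type (Neg p)
}.
Arguments SType {L C V}.

HB.instance Definition _ L (C : structure L) (V : ctx L) :=
  gen_eqMixin (stype C V).
HB.instance Definition _ L (C : structure L) (V : ctx L) :=
  gen_choiceMixin (stype C V).

Section TypeSpace.
Variables (L : language) (C : structure L) (V : ctx L).
Implicit Types (q : stype C V) (p : formula V) (U : set (stype C V)).

Lemma tp_sat (a : tup V C) (F : set (formula V)) :
  finite_set F -> F `<=` [set p | sat p a] ->
  exists a : tup V C, forall p, F p -> sat p a.
Proof. by move=> _ Fa; exists a => p /Fa. Qed.

Lemma tp_complete (a : tup V C) p : sat p a \/ sat (Neg p) a.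
Proof. exact: EM. Qed.

Definition tp (a : tup V C) : stype C V :=
  SType [set p | sat p a] (@tp_sat a) (@tp_complete a).

Definition stype_open U : Prop :=
  forall q, U q ->
    exists2 p, in_type q p & [set r | in_type r p] `<=` U.

Lemma stype_opent : stype_open setT.
Proof.
move=> q _; exists (Neg (Bot V)) => //.
case: (stype_complete q (Bot V)) => // qB.
have [p ->//|a] := @stype_sat _ _ _ q _ (finite_set1 (Bot V)).
by move=> /(_ (Bot V) erefl).
Qed.

Lemma stype_openI : setI_closed stype_open.
Proof.
move=> U W Uo Wo q [/Uo[p1 q1 pU] /Wo[p2 q2 pW]].
pose p := Neg (Imp p1 (Neg p2)).
have imp (r : stype C V) (F : set (formula V)) p' : finite_set F ->
    F `<=` in_type r ->
    (forall a : tup V C, (forall x, F x -> sat x a) -> sat p' a) ->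
    in_type r p'.
  move=> Ff Fr Fp; case: (stype_complete r p') => // rN.
  have [||a aP] := @stype_sat _ _ _ r (F `|` [set Neg p']).
  - by rewrite finite_setU; split => //; exact: finite_set1.
  - by move=> x [/Fr//|->].
  have : sat (Neg p') a by apply: aP; right.
  by rewrite sat_Neg; case; apply: Fp => x Fx; apply: aP; left.
exists p.
  apply: (imp q [set p1; p2]) => [|x [->|->]//|a aP].
    by rewrite finite_setU; split; exact: finite_set1.
  rewrite sat_Neg sat_Imp sat_Neg => h.
  by apply: (h (aP p1 _) (aP p2 _)); [left|right].
move=> r /= rp; split; [apply: pU|apply: pW] => /=.
- apply: (imp r [set p]) => [|x ->//|a /(_ p erefl)];
    first exact: finite_set1.
  rewrite sat_Neg sat_Imp => aP.
  by apply: contrapT => n; apply: aP => /n.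
- apply: (imp r [set p]) => [|x ->//|a /(_ p erefl)];
    first exact: finite_set1.
  rewrite sat_Neg sat_Imp sat_Neg => aP.
  by apply: contrapT => n; apply: aP => _ /n.
Qed.

Lemma stype_open_bigU (I : Type) (f : I -> set (stype C V)) :
  (forall i, stype_open (f i)) -> stype_open (\bigcup_i f i).
Proof.
move=> fo q [i _ /fo[p qp pf]]; exists p => // r /pf fr; by exists i.
Qed.

HB.instance Definition _ := isOpenTopological.Build (stype C V)
  stype_opent stype_openI stype_open_bigU.

End TypeSpace.

Section Substructure.
Variables (L : language) (C : structure L) (M : forall s, set (C s)).
Arguments M : clear implicits.
Hypothesis M0 : forall s, M s !=set0.
Hypothesis Mf : forall (f : fsym L) (x : forall i, C (farg i)),
  (forall i, M _ (x i)) -> M _ (fint C f x).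

Lemma sub_inhabited s : inhabited (M s).
Proof. by have [x Mx] := M0 s; split; exists x; exact: mem_set. Qed.

Definition sub_fint (f : fsym L) (x : forall i, M (farg i)) : M (fres f) :=
  SigSub (mem_set (Mf (fun i => set_valP (x i)))).

Definition substructure : structure L :=
  Structure sub_inhabited sub_fint (fun r x => rint C r (fun i => \val (x i))).

End Substructure.

Record elem_sub L (C : structure L) := ElemSub {
  dom : forall s, set (C s);
  dom0 : forall s, @dom s !=set0;
  dom_closed : forall (f : fsym L) (x : forall i, C (farg i)),
    (forall i, dom (x i)) -> dom (fint C f x);
  dom_elem : forall (V : ctx L) (p : formula V)
    (a : tup V (substructure dom0 dom_closed)),
    sat p a <-> sat (C := C) p (fun v => \val (a v))
}.
Arguments dom {L C} _ s.

(* A model seen as a context, with one variable per element. *)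
Definition ctx_of L (C : structure L) (M : elem_sub C) : ctx L :=
  Ctx (fun x : {s : lsort L & dom M s} => projT1 x).
Coercion ctx_of : elem_sub >-> ctx.

Definition enum_of L (C : structure L) (M : elem_sub C) : tup M C :=
  fun x => \val (projT2 x).
Arguments enum_of {L C} M _.

Definition small_model L (C : structure L) (M : elem_sub C) : Prop :=
  [set: M] #= [set: all_formulas L].

Definition small L (V : ctx L) : Prop := [set: V] #<= [set: all_formulas L].

Record aut L (C : structure L) := Aut {
  afun :> forall s, C s -> C s;
  ainv : forall s, C s -> C s;
  afunK : forall s, cancel (@afun s) (@ainv s);
  ainvK : forall s, cancel (@ainv s) (@afun s);
  aut_fint : forall (f : fsym L) (x : forall i, C (farg i)),
    afun (fint C f x) = fint C f (fun i => afun (x i));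
  aut_rint : forall (r : rsym L) (x : forall i, C (rarg i)),
    rint C r (fun i => afun (x i)) <-> rint C r x
}.
Arguments aut_fint {L C} _ f x.
Arguments aut_rint {L C} _ r x.

HB.instance Definition _ L (C : structure L) := gen_eqMixin (aut C).
HB.instance Definition _ L (C : structure L) := gen_choiceMixin (aut C).

Section AutGroup.
Variables (L : language) (C : structure L).
Implicit Types f g h : aut C.

Lemma autP f g : (forall s (x : C s), f s x = g s x) -> f = g.
Proof.
case: f g => [f fi fK fiK ff fr] [g gi gK giK gf gr] /= fg.
have {}fg : f = g by apply: functional_extensionality_dep => s; apply/funext.
subst g.
have e : fi = gi.
  apply: functional_extensionality_dep => s; apply/funext => x.
  by rewrite -{1}(giK s x) fK.
subst gi.
by rewrite (Prop_irrelevance fK gK) (Prop_irrelevance fiK giK)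
  (Prop_irrelevance ff gf) (Prop_irrelevance fr gr).
Qed.

Definition aut1 : aut C.
Proof. by exists (fun _ x => x) (fun _ x => x). Defined.

Definition autM f g : aut C.
Proof.
exists (fun s => f s \o g s) (fun s => ainv g (s := s) \o ainv f (s := s)) => /=.
- by move=> s; apply: can_comp; exact: afunK.
- by move=> s; apply: can_comp; exact: ainvK.
- by move=> k x; rewrite !aut_fint.
- by move=> r x; rewrite (aut_rint f r (fun i => g _ (x i))) aut_rint.
Defined.

Definition autV f : aut C.
Proof.
exists (ainv f) f.
- exact: ainvK.
- exact: afunK.
- move=> k x; apply: (can_inj (@afunK _ _ f _)).
  rewrite ainvK aut_fint; congr fint.
  by apply: functional_extensionality_dep => i; rewrite ainvK.
- move=> r x; rewrite -(aut_rint f).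
  suff -> : (fun i => f _ (ainv f (x i))) = x by [].
  by apply: functional_extensionality_dep => i; rewrite ainvK.
Defined.

Lemma autMA : associative autM.
Proof. by move=> f g h; apply: autP. Qed.
Lemma aut1M : left_id aut1 autM.
Proof. by move=> f; apply: autP. Qed.
Lemma autM1 : right_id aut1 autM.
Proof. by move=> f; apply: autP. Qed.
Lemma autVM : left_inverse aut1 autV autM.
Proof. by move=> f; apply: autP => s x /=; rewrite afunK. Qed.
Lemma autMV : right_inverse aut1 autV autM.
Proof. by move=> f; apply: autP => s x /=; rewrite ainvK. Qed.

End AutGroup.

(* The product is composition: (f * g) x = f (g x). *)
HB.instance Definition _ L (C : structure L) := isGroup.Build (aut C)
  (@autMA L C) (@aut1M L C) (@autM1 L C) (@autVM L C) (@autMV L C).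

Definition subgroup (G : groupType) (H : set G) : Prop := group_closed [in H].

Definition normal_subgroup (G : groupType) (H : set G) : Prop :=
  subgroup H /\ forall x g : G, H x -> H (x ^ g).

Section Galois.
Variables (L : language) (C : structure L).
Implicit Types (f g : aut C) (M N : elem_sub C).

Definition act (V : ctx L) f (a : tup V C) : tup V C := fun v => f _ (a v).

Definition aut_over M : set (aut C) :=
  [set f | act f (enum_of M) = enum_of M].

Definition Autf : set (aut C) :=
  smallest (@subgroup (aut C))
    (\bigcup_(M in [set M | small_model M]) aut_over M).

Definition gal_rel : rel (aut C) := fun f g => (f^-1 * g) \in Autf.

Lemma Autf_subgroup : subgroup Autf.
Proof.
split=> [|f g /set_mem fA /set_mem gA]; first by apply/mem_set => H [[/set_mem]].
apply/mem_set => H HP; have [[_ HV] _] := HP.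
by apply/set_mem/HV; apply/mem_set; [exact: fA|exact: gA].
Qed.

Lemma gal_rel_refl : reflexive gal_rel.
Proof. by move=> f; rewrite /gal_rel mulVg; case: Autf_subgroup. Qed.

Lemma gal_rel_sym : symmetric gal_rel.
Proof.
have sub f g : gal_rel f g -> gal_rel g f.
  move=> /(group_closedV Autf_subgroup).
  by rewrite /gal_rel invgM invgK.
by move=> f g; apply/idP/idP; exact: sub.
Qed.

Lemma gal_rel_trans : transitive gal_rel.
Proof.
move=> g f h fg gh; have := group_closedM Autf_subgroup fg gh.
by rewrite /gal_rel /= -mulgA mulVKg.
Qed.

Definition gal_equiv := EquivRel gal_rel gal_rel_refl gal_rel_sym gal_rel_trans.

(* Gal_L(T) = Aut(C) / Autf_L(C), as the set of left cosets. *)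
Definition Gal := {eq_quot gal_equiv}%qT.
HB.instance Definition _ := EqQuotient.on Gal.
HB.instance Definition _ := Choice.on Gal.

Definition galj f : Gal := (\pi_Gal f)%qT.

(* S_M(N) = {tp(M'/N) : tp(M') = tp(M)}.  A formula over N in the variables M
   is a formula in the variables M and N in which the variables N are
   interpreted by the elements of N, so tp(M'/N) is encoded as tp(M'N). *)
Definition S_set M N : set (stype C (ctx_cat M N)) :=
  [set q | exists2 a : tup M C,
    tp a = tp (enum_of M) & q = tp (tcat a (enum_of N))].
Arguments S_set : clear implicits.

(* [set_type] carries the subspace topology. *)
Definition S_MN M N : topologicalType := S_set M N.

Lemma eval_act (V : ctx L) f (a : tup V C) s (t : term V s) :
  eval (act f a) t = f s (eval a t).
Proof.
elim: t => //= k u IH; rewrite aut_fint; congr fint.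
by apply: functional_extensionality_dep => i; rewrite IH.
Qed.

Lemma sat_act (V : ctx L) f (p : formula V) (a : tup V C) :
  sat p (act f a) <-> sat p a.
Proof.
elim: p a => {V} /= [V s t u|V r t|V|V p IHp q IHq|V s p IHp] a //.
- by rewrite !eval_act; split => [/(can_inj (@afunK _ _ f s))|->].
- rewrite -[X in _ <-> X](aut_rint f).
  suff -> : (fun i => eval (act f a) (t i)) = (fun i => f _ (eval a (t i))) by [].
  by apply: functional_extensionality_dep => i; rewrite eval_act.
- by rewrite IHp IHq.
- have e x : act f (tsnoc a x) = tsnoc (act f a) (f s x).
    by apply: functional_extensionality_dep; case.
  split=> H x; first by apply/IHp; rewrite e.
  by rewrite -[x](@ainvK _ _ f) -e; apply/IHp.
Qed.

Lemma stypeP (V : ctx L) (q r : stype C V) : in_type q = in_type r -> q = r.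
Proof.
case: q r => [q q1 q2] [r r1 r2] /= qr; subst r.
by rewrite (Prop_irrelevance q1 r1) (Prop_irrelevance q2 r2).
Qed.

Lemma tp_act (V : ctx L) f (a : tup V C) : tp (act f a) = tp a.
Proof. by apply/stypeP/seteqP; split=> p /= /sat_act. Qed.

Lemma mu_subproof M N f :
  S_set M N (tp (tcat (act f (enum_of M)) (enum_of N))).
Proof. by exists (act f (enum_of M)) => //; exact: tp_act. Qed.

Definition mu M N f : S_MN M N := SigSub (mem_set (mu_subproof M N f)).

(* When C is a monster model and M, N are small, mu is onto S_M(N) and nu is
   the only map with galj = nu \o mu, whatever preimage is chosen. *)
Definition nu M N (q : S_MN M N) : Gal := galj (xget 1 [set f | mu M N f = q]).

(* Gal_L(T) with the quotient topology along nu : S_M(N) -> Gal_L(T), which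
   does not depend on the small models M and N. *)
Definition GalTop M N : Type := Gal.
HB.instance Definition _ M N := Choice.on (GalTop M N).

Definition gal_open M N (Y : set (GalTop M N)) : Prop :=
  open (@nu M N @^-1` Y).

Lemma gal_openT M N : gal_open [set: GalTop M N].
Proof. by rewrite /gal_open preimage_setT; exact: openT. Qed.

Lemma gal_openI M N : setI_closed (@gal_open M N).
Proof. by move=> ? ? ? ?; exact: openI. Qed.

Lemma gal_open_bigU M N (I : Type) (f : I -> set (GalTop M N)) :
  (forall i, gal_open (f i)) -> gal_open (\bigcup_i f i).
Proof. by move=> fo; apply: bigcup_open => i _; exact: fo. Qed.

HB.instance Definition _ M N := isOpenTopological.Build (GalTop M N)
  (@gal_openT M N) (@gal_openI M N) (@gal_open_bigU M N).

Definition jcl M N (G : set (aut C)) : set (aut C) :=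
  galj @^-1` closure (galj @` G : set (GalTop M N)).

End Galois.
Arguments Autf {L} C _.

Definition krel L (k : ctx L) (C : structure L) :=
  tup k C -> tup k C -> Prop.

Section Relations.
Variables (L : language) (C : structure L) (k : ctx L).
Implicit Types (E F : krel k C) (a b c : tup k C).

Definition rel_incl E F : Prop := forall a b, E a b -> F a b.

Definition equivalence E : Prop :=
  [/\ forall a, E a a,
      forall a b, E a b -> E b a
    & forall a b c, E a b -> E b c -> E a c].

Definition orbit_rel (H : set (aut C)) : krel k C :=
  fun a b => exists2 f, H f & a = act f b.

Definition type_definable_over (M : elem_sub C) E : Prop :=
  exists P : set (formula (ctx_cat (ctx_cat k k) M)),
    forall a b, E a b <->
      forall p, P p -> sat p (tcat (tcat a b) (enum_of M)).

(* fewer than |K| classes *)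
Definition bounded (K : Type) E : Prop :=
  card_lt (range (fun a => [set b | E a b])) [set: K].

(* E is identified with {tp(a, b) | E a b} in S_{k+k}(0). *)
Definition closure_rel E : krel k C := fun a b =>
  closure [set q | exists a' b', E a' b' /\ q = tp (tcat a' b')]
    (tp (tcat a b)).

Definition thick (p : formula (ctx_cat k k)) : Prop :=
  (forall a b, sat p (tcat a b) -> sat p (tcat b a)) /\
  exists n : nat, forall a : 'I_n -> tup k C,
    exists i l : 'I_n, (i < l)%N /\ sat p (tcat (a i) (a l)).

Definition Theta : krel k C :=
  fun a b => forall p, thick p -> sat p (tcat a b).

Definition comp_rel E F : krel k C :=
  fun a b => exists c, E a c /\ F c b.

End Relations.
Arguments orbit_rel {L C} k H _ _.
Arguments Theta {L C} k _ _.

(* C is a monster model of T for the cardinal |K| > 2^|T|: C is of size at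
   least |K|, |K|-saturated and strongly |K|-homogeneous. *)
Definition monster L (T : set (sentence L)) (K : Type) (C : structure L) :=
  [/\ models C T,
      card_lt [set: set (all_formulas L)] [set: K],
      [set: K] #<= [set: {s : lsort L & C s}],
      (* saturation: 1-types over a tuple b of fewer than |K| parameters *)
      forall (V : ctx L) (b : tup V C) (s : lsort L)
          (P : set (formula (ctx_snoc V s))),
        card_lt [set: V] [set: K] ->
        (forall F, finite_set F -> F `<=` P ->
          exists x : C s, forall p, F p -> sat p (tsnoc b x)) ->
        exists x : C s, forall p, P p -> sat p (tsnoc b x)
    & forall (V : ctx L) (a b : tup V C),
        card_lt [set: V] [set: K] -> tp a = tp b ->
        exists f : aut C, act f a = b].

(* Main.v *)
(* [cl (j G)] has a one-step description: [f] belongs to its preimage iff,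
   modulo [Autf], the type of [f M] over [N] is a limit of types of [g M]
   over [N] with [g] in [G]. By compactness and homogeneity this does not
   depend on the small tuples [M], [N], which makes the set of such [f] a
   group; it is closed because a limit of products [f' * k] with [k] in
   [Autf] is a product of a limit of the [f'] and a limit of the [k]. Part
   (i) is read off from this description.

   For (ii), let [a = f b] with [f] in the closure of the normal group [G].
   Limits over larger and larger sets give pairs [(x_i, y_i)] with the type
   of [(a, b)], all [y_i] in the [G]-orbit of [b], and [(x_j, y_i)] in the
   closure of [E_G] for [i < j]. A thick formula holds of some [(x_i, x_j)]
   with [i < j], and [x_j] is then the intermediate tuple for [(x_i, y_i)].
   Conversely, every symmetric formula implied by a relation that contains
   equality of types over a small model is thick. *)

Require Import Defs.
From mathcomp Require Import all_boot generic_quotient all_classical topology.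

Set Implicit Arguments.
Unset Strict Implicit.
Unset Printing Implicit Defensive.

Local Open Scope classical_set_scope.
Local Open Scope card_scope.
Local Open Scope group_scope.

(* [topology] and [ssrfun] shadow these two names of [Defs]. *)
Local Notation eval := Defs.eval.
Local Notation fsym := Defs.fsym.

(** * Substitution and compactness *)

Section Substitution.
Variable L : language.

Definition substitution (V W : ctx L) := forall v : V, term W (csort v).

Fixpoint term_subst (V W : ctx L) (σ : substitution V W) s (t : term V s) :
    term W s :=
  match t with
  | Var v => σ v
  | App f u => App (fun i => term_subst σ (u i))
  end.

Definition subst_snoc (V W : ctx L) (σ : substitution V W) (s : lsort L) :
    substitution (ctx_snoc V s) (ctx_snoc W s) :=
  fun v => match v with
    | Some x => term_subst (fun y : W => Var (Some y : ctx_snoc W s)) (σ x)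
    | None => Var (None : ctx_snoc W s)
    end.

Fixpoint formula_subst (V : ctx L) (p : formula V) :
    forall W : ctx L, substitution V W -> formula W :=
  match p with
  | Equ s t u => fun W σ => Equ (term_subst σ t) (term_subst σ u)
  | Rel r t => fun W σ => Rel (fun i => term_subst σ (t i))
  | Bot => fun W σ => Bot W
  | Imp p q => fun W σ => Imp (formula_subst p σ) (formula_subst q σ)
  | All s p => fun W σ => All (formula_subst p (@subst_snoc V W σ s))
  end.

Definition And (V : ctx L) (p q : formula V) := Neg (Imp p (Neg q)).
Definition Top (V : ctx L) := Neg (Bot V).
Definition Ex (V : ctx L) s (p : formula (ctx_snoc V s)) := Neg (All (Neg p)).

(** A support is recorded by a predicate, which avoids computing the set of free variables. *)
Fixpoint term_in (V : ctx L) (D : set V) s (t : term V s) : Prop :=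
  match t with
  | Var v => D v
  | App f u => forall i, term_in D (u i)
  end.

Definition set_snoc (V : ctx L) s (D : set V) : set (ctx_snoc V s) :=
  fun v => if v is Some x then D x else True.
Arguments set_snoc {V} s D _.

Fixpoint formula_in (V : ctx L) (p : formula V) : set V -> Prop :=
  match p with
  | Equ s t u => fun D => term_in D t /\ term_in D u
  | Rel r t => fun D => forall i, term_in D (t i)
  | Bot => fun _ => True
  | Imp p q => fun D => formula_in p D /\ formula_in q D
  | All s p => fun D => formula_in p (set_snoc s D)
  end.

Lemma term_in_subst (V W : ctx L) (σ : substitution V W) D E s (t : term V s) :
  (forall v, D v -> term_in E (σ v)) -> term_in D t ->
  term_in E (term_subst σ t).
Proof.
by move=> DE; elim: t => [v|f u IH] /=; [exact: DE|move=> h i; exact: IH].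
Qed.

Lemma formula_in_subst (V : ctx L) (p : formula V) (W : ctx L)
    (σ : substitution V W) D E :
  (forall v, D v -> term_in E (σ v)) -> formula_in p D ->
  formula_in (formula_subst p σ) E.
Proof.
elim: p W σ D E => {V} /= [V s t u|V r t|V|V p IHp q IHq|V s p IHp] W σ D E DE //.
- by case=> h1 h2; split; exact: (term_in_subst DE).
- by move=> h i; exact: (term_in_subst DE).
- by case=> h1 h2; split; [exact: (IHp _ _ _ _ DE)|exact: (IHq _ _ _ _ DE)].
- apply: IHp => -[v|] //= Dv.
  exact: (@term_in_subst _ _ _ E) (DE _ Dv).
Qed.

Lemma term_in_sub (V : ctx L) (D E : set V) s (t : term V s) :
  D `<=` E -> term_in D t -> term_in E t.
Proof.
by move=> DE; elim: t => [v|f u IH] /=; [exact: DE|move=> h i; exact: IH].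
Qed.

Lemma formula_in_sub (V : ctx L) (D E : set V) (p : formula V) :
  D `<=` E -> formula_in p D -> formula_in p E.
Proof.
elim: p D E => {V} /= [V s t u|V r t|V|V p IHp q IHq|V s p IHp] D E DE //.
- by case=> h1 h2; split; exact: (term_in_sub DE).
- by move=> h i; exact: (term_in_sub DE).
- by case=> h1 h2; split; [exact: (IHp _ _ DE)|exact: (IHq _ _ DE)].
- by apply: IHp => -[v|] //=; exact: DE.
Qed.

Lemma term_in_setT (V : ctx L) s (t : term V s) : term_in setT t.
Proof. by elim: t. Qed.

Lemma formula_in_setT (V : ctx L) (p : formula V) : formula_in p setT.
Proof.
elim: p => {V} //= [V s t u|V r t|V s p].
- by split; exact: term_in_setT.
- by move=> i; exact: term_in_setT.
- by apply: formula_in_sub => -[].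
Qed.

Section Chain.
Variables (I : Type) (i0 : I) (le : I -> I -> Prop).
Hypothesis le_total : forall i j, le i j \/ le j i.

Let mono (V : ctx L) (D : I -> set V) := forall i j, le i j -> D i `<=` D j.

Lemma chain_bound (V : ctx L) (D : I -> set V) n (g : 'I_n -> I) :
  mono D -> exists j, forall i, D (g i) `<=` D j.
Proof.
move=> mD; suff [j jP] : exists j, forall i : 'I_n, i \in enum 'I_n -> D (g i) `<=` D j.
  by exists j => i; apply: jP; rewrite mem_enum.
elim: (enum _) => [|i s [j jP]]; first by exists i0.
have [ij|ji] := le_total (g i) j.
  by exists j => k; rewrite in_cons => /orP[/eqP->|/jP//]; exact: mD.
exists (g i) => k; rewrite in_cons => /orP[/eqP->//|/jP kj].
by apply: subset_trans kj _; exact: mD.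
Qed.

Lemma chain_bound2 (V : ctx L) (D : I -> set V) i j :
  mono D -> exists k, D i `<=` D k /\ D j `<=` D k.
Proof.
by move=> mD; have [/mD ij|/mD ji] := le_total i j; [exists j|exists i]; split.
Qed.

Lemma term_in_chain (V : ctx L) (D : I -> set V) s (t : term V s) :
  mono D -> term_in (\bigcup_i D i) t -> exists i, term_in (D i) t.
Proof.
move=> mD; elim: t => [v|f u IH] /=; first by case=> i _ Dv; exists i.
move=> h.
have {h}/choice[g gP] : forall i, exists j, term_in (D j) (u i).
  by move=> i; apply/IH/h.
have [j jP] := chain_bound g mD.
by exists j => i; apply: term_in_sub (gP i); exact: jP.
Qed.

(** The finitely many free variables of [p] lie in one member of the chain. Under a quantifier every
    member is enlarged by the bound variable; [i0] serves where no free variable selects a stage. *)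
Lemma formula_in_chain (V : ctx L) (D : I -> set V) (p : formula V) :
  mono D -> formula_in p (\bigcup_i D i) -> exists i, formula_in p (D i).
Proof.
elim: p D => {V} /= [V s t u|V r t|V|V p IHp q IHq|V s p IHp] D mD.
- case=> /(term_in_chain mD)[i ti] /(term_in_chain mD)[j uj].
  have [k [ik jk]] := chain_bound2 i j mD.
  by exists k; split; [exact: (term_in_sub ik)|exact: (term_in_sub jk)].
- move=> h; have /choice[g gP] : forall i, exists j, term_in (D j) (t i).
    by move=> i; apply/term_in_chain/h.
  have [j jP] := chain_bound g mD.
  by exists j => i; apply: term_in_sub (gP i); exact: jP.
- by exists i0.
- case=> /(IHp _ mD)[i pi] /(IHq _ mD)[j qj].
  have [k [ik jk]] := chain_bound2 i j mD.
  by exists k; split; [exact: (formula_in_sub ik)|exact: (formula_in_sub jk)].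
- move=> h; apply: (IHp (fun i => set_snoc s (D i))).
    by move=> i j ij [v|] //=; exact: mD.
  by apply: formula_in_sub h => -[v|] /=; [case=> i _ Dv; exists i|exists i0].
Qed.

End Chain.
End Substitution.

(** * Substitutions acting on tuples *)

Section Pullback.
Variables (L : language) (C : structure L).

(** All later projections and rearrangements of coordinates have this form, so [sat_subst]
    transports formulas along them. *)
Definition pull (V W : ctx L) (σ : substitution V W) (b : tup W C) : tup V C :=
  fun v => eval b (σ v).

Lemma eval_subst (V W : ctx L) (σ : substitution V W) s (t : term V s)
  (b : tup W C) : eval b (term_subst σ t) = eval (pull σ b) t.
Proof.
elim: t => //= f u IH; congr fint.
by apply: functional_extensionality_dep => i; rewrite IH.
Qed.

Lemma sat_subst (V : ctx L) (p : formula V) (W : ctx L) (σ : substitution V W)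
  (b : tup W C) : sat (formula_subst p σ) b <-> sat p (pull σ b).
Proof.
elim: p W σ b => {V} /= [V s t u|V r t|V|V p IHp q IHq|V s p IHp] W σ b //.
- by rewrite !eval_subst.
- suff -> : (fun i => eval b (term_subst σ (t i))) =
            (fun i => eval (pull σ b) (t i)) by [].
  by apply: functional_extensionality_dep => i; rewrite eval_subst.
- by rewrite IHp IHq.
- have e x : pull (@subst_snoc _ V W σ s) (tsnoc b x) = tsnoc (pull σ b) x.
    by apply: functional_extensionality_dep => -[v|] //=; exact: eval_subst.
  by split=> h x; have := h x; rewrite IHp e.
Qed.

Lemma sat_And (V : ctx L) (p q : formula V) (a : tup V C) :
  sat (And p q) a <-> sat p a /\ sat q a.
Proof.
rewrite /= ; split=> [h|[hp hq] h]; last exact: h.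
by split; apply: contrapT => n; apply: h.
Qed.

Lemma sat_Top (V : ctx L) (a : tup V C) : sat (Top V) a.
Proof. by rewrite sat_Neg. Qed.

Lemma sat_Ex (V : ctx L) s (p : formula (ctx_snoc V s)) (a : tup V C) :
  sat (Ex p) a <-> exists x, sat p (tsnoc a x).
Proof.
rewrite /=; split=> [h|[x px] /(_ x)//].
by apply: contrapT => n; apply: h => x px; apply: n; exists x.
Qed.

Lemma eval_in (V : ctx L) (D : set V) (a b : tup V C) s (t : term V s) :
  (forall v, D v -> a v = b v) -> term_in D t -> eval a t = eval b t.
Proof.
move=> ab; elim: t => [v|f u IH] /=; first exact: ab.
by move=> h; congr fint; apply: functional_extensionality_dep => i; exact: IH.
Qed.

Lemma sat_in (V : ctx L) (p : formula V) (D : set V) (a b : tup V C) :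
  (forall v, D v -> a v = b v) -> formula_in p D -> sat p a <-> sat p b.
Proof.
elim: p D a b => {V} /= [V s t u|V r t|V|V p IHp q IHq|V s p IHp] D a b ab //.
- by case=> h1 h2; rewrite (eval_in ab h1) (eval_in ab h2).
- move=> h; suff -> : (fun i => eval a (t i)) = (fun i => eval b (t i)) by [].
  by apply: functional_extensionality_dep => i; exact: (eval_in ab).
- by case=> h1 h2; rewrite (IHp _ _ _ ab h1) (IHq _ _ _ ab h2).
- move=> h; have e x : sat p (tsnoc a x) <-> sat p (tsnoc b x).
    by apply: IHp h => -[v|] //=; exact: ab.
  by split=> k x; apply/e.
Qed.

Lemma tpP (V : ctx L) (a b : tup V C) :
  (forall p, sat p a -> sat p b) -> tp a = tp b.
Proof.
move=> h; apply/stypeP/seteqP; split=> p /=; first exact: h.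
by move=> pb; apply: contrapT => n; apply: (h (Neg p)).
Qed.

Lemma tp_satP (V : ctx L) (a b : tup V C) p : tp a = tp b -> sat p a -> sat p b.
Proof. by move=> ab pa; have : in_type (tp a) p by []; rewrite ab. Qed.

Lemma pull_act (V W : ctx L) (σ : substitution V W) f (a : tup W C) :
  pull σ (act f a) = act f (pull σ a).
Proof. by apply: functional_extensionality_dep => v; exact: eval_act. Qed.

End Pullback.

#[export] Hint Resolve sat_Top : core.

(** * Realizing types in many variables by saturation *)

Section Realization.
Variables (L : language) (T : set (sentence L)) (K : Type) (C : structure L).
Hypothesis CM : monster T K C.

Section Ultra.
Variables (W : ctx L) (G : set_system (tup W C)).
Hypotheses (Wlt : card_lt [set: W] [set: K]) (UG : UltraFilter G).

Let holds (p : formula W) := G [set w | sat p w].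

(** Only the coordinates of [a] in [D] matter; the others are arbitrary fillers, which keeps the
    context fixed. *)
Let partial_real (D : set W) (a : tup W C) :=
  forall p, formula_in p D -> holds p -> sat p a.

Section Update.
Variable w0 : W.

(** Saturation concerns 1-types over a tuple: [w0] becomes the fresh variable [None], and the
    remaining variables refer to the parameter tuple. *)
Definition subst_new : substitution W (ctx_snoc W (csort w0)) := fun v =>
  match pselect (w0 = v) with
  | left e => match e in _ = u return term (ctx_snoc W (csort w0)) (csort u) with
      erefl => Var (None : ctx_snoc W (csort w0)) end
  | right _ => Var (Some v : ctx_snoc W (csort w0))
  end.

Lemma pull_new_neq (a : tup W C) x v : w0 <> v ->
  pull subst_new (tsnoc a x) v = a v.
Proof. by rewrite /pull /subst_new => n; case: pselect. Qed.

Lemma pull_new_id (a : tup W C) : pull subst_new (tsnoc a (a w0)) = a.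
Proof.
apply: functional_extensionality_dep => v.
by rewrite /pull /subst_new; case: pselect => // e; case: v / e.
Qed.

Lemma subst_new_in (D : set W) v : (w0 |` D) v ->
  term_in (set_snoc (s := csort w0) D) (subst_new v).
Proof.
by rewrite /subst_new; case: pselect => [e _|n [/esym//|]] //; case: v / e.
Qed.

(** If [r] has its support in [D] and [w0], quantifying [w0] existentially gives a formula with
    support in [D], which [a] satisfies. Finitely many such formulas reduce to their conjunction,
    and saturation yields the new value at [w0]. *)
Lemma partial_real_extend (D : set W) (a : tup W C) : partial_real D a ->
  exists b, [/\ partial_real (w0 |` D) b & forall v, w0 <> v -> a v = b v].
Proof.
move=> Da; case: CM => _ _ _ sat_C _.
pose P := [set formula_subst p subst_new | p in
            [set p | formula_in p (w0 |` D) /\ holds p]].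
have [|x xP] := sat_C _ a (csort w0) P Wlt.
  move=> F /finite_setP[n].
  have H r : formula_in r (w0 |` D) -> holds r ->
      exists x, sat (formula_subst r subst_new) (tsnoc a x).
    move=> rD rG; apply/sat_Ex/Da.
      split=> //; split=> //; apply: formula_in_subst rD => v; exact: subst_new_in.
    apply: filterS rG => w /= rw; apply/sat_Ex; exists (w w0).
    by apply/sat_subst; rewrite pull_new_id.
  move=> Fn FP; suff [r [rD rG rF]] : exists r, [/\ formula_in r (w0 |` D),
      holds r & forall (x : C (csort w0)) p, F p ->
        sat (C := C) (formula_subst r subst_new) (tsnoc a x) -> sat p (tsnoc a x)].
    by have [x rx] := H r rD rG; exists x => p /rF; exact.
  elim: n F Fn FP => [|n IH] F.
    rewrite II0 card_eq0 => /eqP-> _; exists (Top W); split => //.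
    by apply: filterS filterT => w _; exact: sat_Top.
  move=> /eq_cardSP[p Fp /IH Fn] FP.
  have [r [rD rG rF]] := Fn (subset_trans (@subDsetl _ _ _) FP).
  have [q [qD qG] qp] := FP _ Fp.
  exists (And r q); split.
  - by [].
  - apply: filterS (filterI rG qG) => w [] rw qw; exact/sat_And.
  - move=> x u Fu /sat_subst/sat_And[rx qx].
    have [->|up] := pselect (u = p); first by rewrite -qp; exact/sat_subst.
    by apply: rF; [split|exact/sat_subst].
exists (pull subst_new (tsnoc a x)); split=> [p pD pG|v /pull_new_neq ->//].
by apply/sat_subst/xP; exists p.
Qed.

End Update.

(** Zorn's lemma for partial realizations ordered by extension. A chain has its union as upper
    bound, because a formula over the union already lives at one stage; [partial_real_extend] forces
    a maximal domain to be everything. *)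
Lemma ultra_realized : exists a : tup W C, forall p, holds p -> sat p a.
Proof.
have [a0 _] : [set: tup W C] !=set0 by apply: (@filter_ex _ G); exact: filterT.
(* A formula with empty support has the same truth value at every tuple. *)
have P0 : partial_real set0 a0.
  move=> p p0 /filter_ex[w pw].
  by rewrite (@sat_in _ _ _ _ set0 a0 w).
pose PR := {x : set W * tup W C | partial_real x.1 x.2}.
pose R (x y : PR) := `[< (sval x).1 `<=` (sval y).1 /\
  forall v, (sval x).1 v -> (sval x).2 v = (sval y).2 v >].
have [||A tot|[[D a] Da] max] := @ZL_preorder PR (exist _ (set0, a0) P0) R.
- by move=> x; apply/asboolP; split.
- move=> y x z /asboolP[xy xy'] /asboolP[yz yz']; apply/asboolP; split.
    exact: subset_trans yz.
  by move=> v xv; rewrite xy'// yz'//; exact: xy.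
- have [[x0 Ax0]|A0] := pselect (A !=set0); last first.
    exists (exist _ (set0, a0) P0) => s As; case: A0; by exists s.
  pose I := {x | A x}.
  pose D (i : I) := (sval (sval i)).1.
  pose a (i : I) := (sval (sval i)).2.
  have RI i j : (D i `<=` D j /\ forall v, D i v -> a i v = a j v) \/
                (D j `<=` D i /\ forall v, D j v -> a j v = a i v).
    by have [/asboolP|/asboolP] := tot _ _ (svalP i) (svalP j); [left|right].
  (* [h v] is a stage of the chain that contains [v], and an arbitrary stage if there is none. *)
  have /choice[h hP] : forall v, exists i, (\bigcup_i D i) v -> D i v.
    move=> v; have [[i _ iv]|n] := pselect ((\bigcup_i D i) v); first by exists i.
    by exists (exist _ x0 Ax0) => /n.
  pose b : tup W C := fun v => a (h v) v.
  have bE i v : D i v -> b v = a i v.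
    move=> iv; have hv : D (h v) v by apply: hP; exists i.
    by rewrite /b; have [[_ ->//]|[_ ->//]] := RI (h v) i.
  have Pb : partial_real (\bigcup_i D i) b.
    move=> p pD pG.
    have Dtot i j : D i `<=` D j \/ D j `<=` D i.
      by have [[]|[]] := RI i j; [left|right].
    have [//|i iP] := formula_in_chain (exist _ x0 Ax0) Dtot _ pD.
    rewrite (@sat_in _ _ _ _ (D i) b (a i))//; last exact: bE.
    exact: (svalP (sval i)).
  exists (exist _ (\bigcup_i D i, b) Pb) => s As; apply/asboolP => /=.
  split=> [v sv|v sv]; first by exists (exist _ s As).
  by rewrite (bE (exist _ s As)).
- exists a => p; apply: (Da) => /=.
  suff -> : D = setT by exact: formula_in_setT.
  rewrite -subTset => v _; apply: contrapT => nv.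
  have [b [Db ab]] := partial_real_extend v Da.
  have /max/asboolP[/= + _] : R (exist _ (D, a) Da) (exist _ (v |` D, b) Db).
    apply/asboolP; split=> [u Du|u Du] /=; first by right.
    by apply: ab => vu; apply: nv; rewrite vu.
  by move=> sub; apply/nv/sub; left.
Qed.

End Ultra.

(* Directedness replaces closure under finite conjunctions. *)
Lemma compactness (W : ctx L) (P : set (formula W)) :
  card_lt [set: W] [set: K] -> P !=set0 ->
  (forall p q, P p -> P q -> exists2 r, P r &
    forall w : tup W C, sat r w -> sat p w /\ sat q w) ->
  (forall p, P p -> exists w : tup W C, sat p w) ->
  exists w : tup W C, forall p, P p -> sat p w.
Proof.
move=> Wlt P0 Pdir Psat.
have [|G [UG PG]] := @ultraFilterLemma _
    (filter_from P (fun p => [set w : tup W C | sat p w])).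
  by apply: filter_from_proper; [exact: filter_from_filter|exact: Psat].
have [a aP] := ultra_realized Wlt UG.
by exists a => p Pp; apply/aP/PG; exists p.
Qed.

Lemma homogeneous (V : ctx L) (a b : tup V C) :
  card_lt [set: V] [set: K] -> tp a = tp b -> exists f : aut C, act f a = b.
Proof. by case: CM => _ _ _ _ hom /hom; exact. Qed.

End Realization.

(** * Cardinality of the set of formulas *)

Lemma existT_inj_tagged (T : Type) (P : T -> Type) x (p q : P x) :
  existT P x p = existT P x q -> p = q.
Proof. exact: (@existT_inj2 {classic T}). Qed.

Lemma card_setT_leP (X Y : Type) :
  [set: X] #<= [set: Y] <-> exists f : X -> Y, injective f.
Proof.
split=> [/card_leP sq|[f fI]]; first case: sq => f.
  exists (fun x => val (f (SigSub (mem_set (I : [set: X] x))))) => x y /val_inj.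
  by move=> /(@inj _ _ _ f); rewrite !in_setT => /(_ isT isT)[].
have /injfunPex sq : exists2 g : X -> Y, set_fun setT setT g & set_inj setT g.
  by exists f => // x y _ _; exact: fI.
by case: sq => g; exact: (inj_card_le g).
Qed.

Lemma card_le_powerset (X Y : Type) :
  [set: X] #<= [set: Y] -> [set: set X] #<= [set: set Y].
Proof.
move=> /card_setT_leP[f fI]; apply/card_setT_leP; exists (fun A => f @` A).
move=> A B AB; apply/seteqP; split=> x Ax.
- have [y By /fI<-//] : (f @` B) (f x) by rewrite -AB; exists x.
- have [y By /fI<-//] : (f @` A) (f x) by rewrite AB; exists x.
Qed.

Section Coding.
Variable L : language.

(** Indexed by ['I_0] rather than [void], so that its formulas sit directly inside [all_formulas]
    with [n = 0]. *)
Let ctxI0 : ctx L :=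
  Ctx (fun i : 'I_0 => False_rect (lsort L) (notF (ltn_ord i))).

(* Formulas in one fixed context have the injective pairing [Imp]. *)
Let S0 := formula ctxI0.
Let bot : S0 := Bot ctxI0.

Fixpoint code_nat (n : nat) : S0 :=
  if n is m.+1 then Imp bot (code_nat m) else bot.

Lemma code_nat_inj : injective code_nat.
Proof. by elim=> [|m IH] [|n] //= [/IH->]. Qed.

Definition code_seq (s : seq S0) : S0 := foldr (@Imp L ctxI0) bot s.

Lemma code_seq_inj : injective code_seq.
Proof. by elim=> [|x s IH] [|y t] //= [-> /IH->]. Qed.

Definition code_ord n (g : 'I_n -> S0) : S0 := code_seq (codom g).

Lemma code_ord_inj n (g h : 'I_n -> S0) : code_ord g = code_ord h -> g =1 h.
Proof. by move=> /code_seq_inj/eq_in_map gh i; apply: gh; rewrite mem_enum. Qed.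

Fixpoint close (l : seq (lsort L)) :
    forall V : ctx L, formula (foldl (@ctx_snoc L) V l) -> formula V :=
  match l with
  | [::] => fun V p => p
  | s :: l' => fun V p => All (@close l' (ctx_snoc V s) p)
  end.

Lemma var_foldl (l : seq (lsort L)) (V : ctx L) (v : V) :
  exists w : foldl (@ctx_snoc L) V l, csort w = csort v.
Proof.
elim: l V v => [|s l IH] V v; first by exists v.
exact: IH (ctx_snoc V s) (Some v).
Qed.

Lemma var_of_sort n (s : 'I_n -> lsort L) (e : seq 'I_n) (V : ctx L) i :
  i \in e -> exists w : foldl (@ctx_snoc L) V (map s e), csort w = s i.
Proof.
elim: e V => [|j e IH] V //; rewrite in_cons => /orP[/eqP->|/IH]; last exact.
exact: (@var_foldl (map s e) (ctx_snoc V (s j)) None).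
Qed.

Let args_ctx n (s : 'I_n -> lsort L) : ctx L :=
  foldl (@ctx_snoc L) ctxI0 (map s (enum 'I_n)).

Let args n (s : 'I_n -> lsort L) (i : 'I_n) : term (args_ctx s) (s i) :=
  let: exist w e := cid (var_of_sort s ctxI0 (mem_enum predT i)) in
  ecast u (term (args_ctx s) u) e (Var w).

Fixpoint head_fsym (V : ctx L) (p : formula V) : option (fsym L) :=
  match p with
  | All s q => head_fsym q
  | Equ s t u => if t is App f _ then Some f else None
  | _ => None
  end.

Fixpoint head_rsym (V : ctx L) (p : formula V) : option (rsym L) :=
  match p with
  | All s q => head_rsym q
  | Rel r _ => Some r
  | _ => None
  end.

(** The symbol is applied to variables of its argument sorts, and quantifying them gives a formula
    in the fixed context. Which variables of the right sorts are chosen is immaterial, since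
    [head_fsym] reads only the symbol below the quantifiers. *)
Definition code_fsym (f : fsym L) : S0 :=
  close (Equ (App (args (@farg L f))) (App (args (@farg L f)))).

Definition code_rsym (r : rsym L) : S0 := close (Rel (args (@rarg L r))).

Definition code_sort (s : lsort L) : S0 := All (Bot (ctx_snoc ctxI0 s)).

Lemma code_fsym_inj : injective code_fsym.
Proof.
have e (l : seq (lsort L)) V p : head_fsym (@close l V p) = head_fsym p.
  by elim: l V p => //= s l IH V p; rewrite IH.
by move=> f g /(congr1 (@head_fsym _)); rewrite !e => -[].
Qed.

Lemma code_rsym_inj : injective code_rsym.
Proof.
have e (l : seq (lsort L)) V p : head_rsym (@close l V p) = head_rsym p.
  by elim: l V p => //= s l IH V p; rewrite IH.
by move=> f g /(congr1 (@head_rsym _)); rewrite !e => -[].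
Qed.

Lemma code_sort_inj : injective code_sort.
Proof. by move=> s t []. Qed.

(** Here and in [code_formula], the premise [bot] or [code_nat n] in front is a tag for the
    constructor. *)
Fixpoint code_term (V : ctx L) (c : V -> S0) s (t : term V s) : S0 :=
  match t with
  | Var v => Imp bot (c v)
  | App f u =>
      Imp (code_nat 1) (Imp (code_fsym f) (code_ord (fun i => code_term c (u i))))
  end.

Definition code_snoc (V : ctx L) (c : V -> S0) s (v : ctx_snoc V s) : S0 :=
  if v is Some x then Imp bot (c x) else bot.

Fixpoint code_formula (V : ctx L) (p : formula V) : (V -> S0) -> S0 :=
  match p with
  | Equ s t u => fun c => Imp bot (Imp (code_term c t) (code_term c u))
  | Rel r t => fun c => Imp (code_nat 1)
      (Imp (code_rsym r) (code_ord (fun i => code_term c (t i))))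
  | Bot => fun c => Imp (code_nat 2) bot
  | Imp p q => fun c => Imp (code_nat 3) (Imp (code_formula p c) (code_formula q c))
  | All s p => fun c => Imp (code_nat 4)
      (Imp (code_sort s) (code_formula p (code_snoc c (s := s))))
  end.

Lemma code_term_inj (V : ctx L) (c : V -> S0) s (t : term V s) s' (t' : term V s') :
  injective c -> code_term c t = code_term c t' ->
  existT (fun s => term V s) s t = existT (fun s => term V s) s' t'.
Proof.
move=> cI; elim: t s' t' => [v|f u IH] s' [w|g u'] //=.
  by move=> [/cI->].
move=> [/code_fsym_inj fg]; case: g / fg u' => u' /code_ord_inj uu'.
suff -> : u = u' by [].
apply: functional_extensionality_dep => i; exact: existT_inj_tagged (IH i _ _ (uu' i)).
Qed.

Lemma code_snoc_inj (V : ctx L) (c : V -> S0) s :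
  injective c -> injective (@code_snoc V c s).
Proof. by move=> cI [x|] [y|] //= [] // /cI->. Qed.

Lemma code_formula_inj (V : ctx L) (c : V -> S0) (p q : formula V) :
  injective c -> code_formula p c = code_formula q c -> p = q.
Proof.
elim: p c q => {V} [V s t u|V r t|V|V p IHp q IHq|V s p IHp] c
    [s' t' u'|r' t'||p' q'|s' p'] cI //=.
- move=> [/(code_term_inj cI) tt' /(code_term_inj cI) uu'].
  have ss' := existT_inj1 tt'; case: s' / ss' t' u' tt' uu' => t' u'.
  by move=> tt' uu'; rewrite (existT_inj_tagged tt') (existT_inj_tagged uu').
- move=> [/code_rsym_inj rr']; case: r' / rr' t' => t' /code_ord_inj tt'.
  suff -> : t = t' by [].
  apply: functional_extensionality_dep => i.
  exact/existT_inj_tagged/(code_term_inj cI)/tt'.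
- by move=> [/(IHp _ _ cI)-> /(IHq _ _ cI)->].
- move=> [ss']; case: s' / ss' p' => p'.
  by move=> /IHp->//; exact: code_snoc_inj.
Qed.

Definition code_all (p : all_formulas L) : S0 :=
  let: existT n (existT s q) := p in
  Imp (code_nat n) (Imp (code_ord (fun i => code_sort (s i)))
    (code_formula q (fun i => code_nat i))).

Lemma code_all_inj : injective code_all.
Proof.
move=> [n [s p]] [m [t q]] /= [/code_nat_inj nm].
case: m / nm t q => t q /code_ord_inj st.
have {}st : s = t by apply/funext => i; apply/code_sort_inj/st.
case: t / st q => q /code_formula_inj -> // i j /code_nat_inj; exact: val_inj.
Qed.

Lemma S0_all_inj :
  injective (fun p : S0 => existT _ 0%N (existT _ _ p) : all_formulas L).
Proof.
move=> p q pq; have := existT_inj_tagged pq; exact: existT_inj_tagged.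
Qed.

(** Injections into [S0] can be combined by means of [Imp], so no cardinal arithmetic is needed for
    sums and for products with [nat]. *)
Lemma smallP (V : ctx L) : small V <-> exists c : V -> S0, injective c.
Proof.
split=> [|/card_setT_leP h]; last first.
  apply: card_le_trans h _; apply/card_setT_leP; exact: ex_intro S0_all_inj.
move=> h; apply/card_setT_leP/(card_le_trans h)/card_setT_leP.
by exists code_all; exact: code_all_inj.
Qed.

Lemma formula_le (V : ctx L) : small V -> [set: formula V] #<= [set: all_formulas L].
Proof.
move=> /smallP[c cI]; apply/card_setT_leP.
exists (fun p => existT _ 0%N (existT _ _ (code_formula p c))) => p q.
by move=> /S0_all_inj/(code_formula_inj cI).
Qed.

(** Allows a whole sequence of [k]-tuples to serve as one parameter tuple in [limit_step]. *)
Lemma small_prod_nat (V : ctx L) :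
  small V -> small (Ctx (fun x : nat * V => csort x.2)).
Proof.
move=> /smallP[c cI]; apply/smallP; exists (fun x => Imp (code_nat x.1) (c x.2)).
by move=> [n v] [m w] /= [/code_nat_inj-> /cI->].
Qed.

Lemma small_cat (V W : ctx L) : small V -> small W -> small (ctx_cat V W).
Proof.
move=> /smallP[c cI] /smallP[d dI]; apply/smallP.
exists (fun x : V + W => match x with
  | inl v => Imp bot (c v)
  | inr w => Imp (code_nat 1) (d w)
  end).
by move=> [v|v] [w|w] //= [] => [/cI|/dI] ->.
Qed.

Lemma small_model_small (C : structure L) (M : elem_sub C) :
  small_model M -> small M.
Proof. by rewrite /small_model card_eq_le => /andP[]. Qed.

End Coding.

(** * Limits of tuples and Lascar strong automorphisms *)

Section Limits.
Variables (L : language) (T : set (sentence L)) (K : Type) (C : structure L).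

(* The tuples whose type lies in the closure of [{tp b | A b}]. *)
Definition tcl (V : ctx L) (A : set (tup V C)) : set (tup V C) :=
  [set a | forall p, (forall b, A b -> sat p b) -> sat p a].

Lemma subset_tcl (V : ctx L) (A : set (tup V C)) : A `<=` tcl A.
Proof. by move=> a Aa p; exact. Qed.

Lemma tcl_tcl (V : ctx L) (A B : set (tup V C)) :
  A `<=` tcl B -> tcl A `<=` tcl B.
Proof. by move=> AB a Aa p pB; apply: Aa => b /AB; exact. Qed.

Lemma tcl_sub (V : ctx L) (A B : set (tup V C)) : A `<=` B -> tcl A `<=` tcl B.
Proof. by move=> AB; apply: tcl_tcl => a /AB; exact: subset_tcl. Qed.

Lemma tcl_meets (V : ctx L) (A : set (tup V C)) a p :
  tcl A a -> sat p a -> exists2 b, A b & sat p b.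
Proof.
move=> Aa pa; apply: contrapT => n.
by apply: (Aa (Neg p)) pa => b Ab pb; apply: n; exists b.
Qed.

Lemma tcl_tp (V : ctx L) (A : set (tup V C)) a b :
  tp a = tp b -> tcl A a -> tcl A b.
Proof. by move=> ab Aa p /Aa; exact: tp_satP. Qed.

Lemma tcl_pull (V W : ctx L) (σ : substitution V W) (A : set (tup W C))
    (B : set (tup V C)) w :
  (forall u, A u -> tcl B (pull σ u)) -> tcl A w -> tcl B (pull σ w).
Proof.
by move=> AB Aw p pB; apply/sat_subst/Aw => u /AB Bu; exact/sat_subst/Bu.
Qed.

Lemma tcl_tp_const (V W : ctx L) (σ : substitution V W) (A : set (tup W C)) w a :
  (forall u, A u -> tp (pull σ u) = tp a) -> tcl A w -> tp (pull σ w) = tp a.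
Proof.
move=> Aa Aw; apply/esym/tpP => p pa; apply/sat_subst/Aw => u /Aa ua.
exact/sat_subst/(tp_satP (esym ua)).
Qed.

(** Equality of the types of two projections is a closed condition: it is expressed by the
    implications from [p] at [σ] to [p] at [τ], all true on [A]. *)
Lemma tcl_tp_eq (V W : ctx L) (σ τ : substitution V W) (A : set (tup W C)) w :
  (forall u, A u -> tp (pull σ u) = tp (pull τ u)) -> tcl A w ->
  tp (pull σ w) = tp (pull τ w).
Proof.
move=> Aa Aw; apply: tpP => p /sat_subst pw; apply/sat_subst; move: pw.
apply: (Aw (Imp _ _)) => u /Aa ua /sat_subst pu.
exact/sat_subst/(tp_satP ua).
Qed.

Hypothesis CM : monster T K C.

Lemma small_lt (V : ctx L) : small V -> card_lt [set: V] [set: K].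
Proof.
case: CM => _ [le nle] _ _ _ Vs.
have Vle : [set: V] #<= [set: set (all_formulas L)].
  apply: card_le_trans Vs _; apply/card_setT_leP; exists set1 => x y xy.
  by have : [set y] x by rewrite -xy.
split; first exact: card_le_trans Vle le.
by move=> KV; apply: nle; exact: card_le_trans KV Vle.
Qed.

Lemma homogeneous2 (V W : ctx L) (a a' : tup V C) (b b' : tup W C) :
  small V -> small W -> tp (tcat a b) = tp (tcat a' b') ->
  exists f : aut C, act f a = a' /\ act f b = b'.
Proof.
move=> Vs Ws /(homogeneous CM (small_lt (small_cat Vs Ws)))[f fab].
exists f; split; apply: functional_extensionality_dep => v.
- exact: (congr1 (fun g : tup (ctx_cat V W) C => g (inl v)) fab).
- exact: (congr1 (fun g : tup (ctx_cat V W) C => g (inr v)) fab).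
Qed.

(** Compactness for the formulas of [tp a] along [σ], of [tp b] along [τ], and those true on [A].
    This prescribes both projections up to type; a final automorphism turns one of them, along [σ],
    into equality. *)
Lemma tcl_lift2 (V V' W : ctx L) (σ : substitution V W) (τ : substitution V' W)
    (A : set (tup W C)) a b :
  small V -> small W ->
  (forall p q, sat p a -> sat q b ->
     exists u, [/\ A u, sat p (pull σ u) & sat q (pull τ u)]) ->
  exists w, [/\ tcl A w, pull σ w = a & tp (pull τ w) = tp b].
Proof.
move=> Vs Ws AP.
pose P : set (formula W) := [set r | exists p q t,
  [/\ sat p a, sat q b, forall u, A u -> sat t u &
  r = And (And (formula_subst p σ) (formula_subst q τ)) t]].
have [|||w wP] := @compactness _ _ _ _ CM W P (small_lt Ws).
- by exists (And (And (formula_subst (Top V) σ) (formula_subst (Top V') τ))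
    (Top W)), (Top V), (Top V'), (Top W).
- move=> _ _ [p [q [t [pa qb At ->]]]] [p' [q' [t' [pa' qb' At' ->]]]].
  exists (And (And (formula_subst (And p p') σ) (formula_subst (And q q') τ)) (And t t')).
    exists (And p p'), (And q q'), (And t t'); split=> //.
    - exact/sat_And.
    - exact/sat_And.
    - by move=> u Au; apply/sat_And; split; [exact: At|exact: At'].
  move=> w /sat_And[/sat_And[/sat_subst/sat_And[h1 h2] /sat_subst/sat_And[h3 h4]] /sat_And[h5 h6]].
  by split; apply/sat_And; split=> //; apply/sat_And; split; exact/sat_subst.
- move=> _ [p [q [t [pa qb At ->]]]].
  have [u [Au pu qu]] := AP _ _ pa qb.
  exists u; apply/sat_And; split; last exact: At.
  by apply/sat_And; split; exact/sat_subst.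
have wa : tp a = tp (pull σ w).
  apply: tpP => p pa.
  have /wP/sat_And[/sat_And[/sat_subst//]] : P
    (And (And (formula_subst p σ) (formula_subst (Top V') τ)) (Top W)).
  by exists p, (Top V'), (Top W).
have wb : tp b = tp (pull τ w).
  apply: tpP => q qb.
  have /wP/sat_And[/sat_And[_ /sat_subst//]] : P
    (And (And (formula_subst (Top V) σ) (formula_subst q τ)) (Top W)).
  by exists (Top V), q, (Top W).
have wA : tcl A w.
  move=> t At.
  have /wP/sat_And[_ //] : P (And (And (formula_subst (Top V) σ)
    (formula_subst (Top V') τ)) t).
  by exists (Top V), (Top V'), t.
have [f fw] := homogeneous CM (small_lt Vs) (esym wa).
exists (act f w); split.
- exact: tcl_tp (esym (tp_act f w)) wA.
- by rewrite pull_act.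
- by rewrite pull_act tp_act.
Qed.

(** Projections of closed sets of types are closed: a limit of projections is the projection of a
    limit. *)
Lemma tcl_lift (V W : ctx L) (σ : substitution V W) (A : set (tup W C))
    (B : set (tup V C)) a :
  small V -> small W -> (forall b, B b -> exists2 u, A u & pull σ u = b) ->
  tcl B a -> exists2 w, tcl A w & pull σ w = a.
Proof.
move=> Vs Ws BA Ba.
have [||p q pa qa|w [wA wa _]] := @tcl_lift2 V V W σ σ A a a; last by exists w.
- by [].
- by [].
have [b /BA[u Au ub] /sat_And[pb qb]] := tcl_meets Ba (iffRL (sat_And p q a) (conj pa qa)).
by exists u; rewrite ub.
Qed.

(** Compactness with a prescribed subtuple: [tp a] is added to [P], and an automorphism, which
    preserves [P], moves the subtuple found onto [a]. *)
Lemma compactness_over (V W : ctx L) (σ : substitution V W) (a : tup V C)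
    (P : set (formula W)) :
  small V -> small W -> P !=set0 ->
  (forall p q, P p -> P q -> exists2 r, P r &
    forall w : tup W C, sat r w -> sat p w /\ sat q w) ->
  (forall p, P p -> exists2 w : tup W C, sat p w & pull σ w = a) ->
  exists2 w : tup W C, (forall p, P p -> sat p w) & pull σ w = a.
Proof.
move=> Vs Ws [p0 Pp0] Pdir PP.
pose Q : set (formula W) := [set r | exists p q,
  [/\ P p, sat q a & r = And p (formula_subst q σ)]].
have [|||w wQ] := @compactness _ _ _ _ CM W Q (small_lt Ws).
- by exists (And p0 (formula_subst (Top V) σ)), p0, (Top V).
- move=> _ _ [p [q [Pp qa ->]]] [p' [q' [Pp' qa' ->]]].
  have [r Pr rP] := Pdir _ _ Pp Pp'.
  exists (And r (formula_subst (And q q') σ)).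
    by exists r, (And q q'); split=> //; exact/sat_And.
  move=> w /sat_And[/rP[h1 h2] /sat_subst/sat_And[h3 h4]].
  by split; apply/sat_And; split=> //; exact/sat_subst.
- move=> _ [p [q [Pp qa ->]]]; have [w pw wa] := PP _ Pp.
  by exists w; apply/sat_And; split=> //; apply/sat_subst; rewrite wa.
have wa : tp a = tp (pull σ w).
  apply: tpP => q qa.
  have /wQ/sat_And[_ /sat_subst//] : Q (And p0 (formula_subst q σ)).
  by exists p0, q.
have [f fw] := homogeneous CM (small_lt Vs) (esym wa).
exists (act f w); last by rewrite pull_act.
move=> p Pp; apply/sat_act.
have /wQ/sat_And[//] : Q (And p (formula_subst (Top V) σ)).
by exists p, (Top V).
Qed.

End Limits.

Lemma sat_iso (L : language) (A B : structure L) (e : forall s, A s -> B s) :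
  (forall s, injective (@e s)) -> (forall s y, exists x, @e s x = y) ->
  (forall f x, e _ (fint A f x) = fint B f (fun i => e _ (x i))) ->
  (forall r x, rint B r (fun i => e _ (x i)) <-> rint A r x) ->
  forall (V : ctx L) (p : formula V) (a : tup V A),
  sat (C := B) p (fun v => e _ (a v)) <-> sat p a.
Proof.
move=> eI eS ef er.
have ev (V : ctx L) s (t : term V s) (a : tup V A) :
    eval (C := B) (fun v => e _ (a v)) t = e _ (eval a t).
  elim: t => //= f u IH; rewrite ef; congr fint.
  by apply: functional_extensionality_dep => i; rewrite IH.
move=> V p; elim: p => {V} /= [V s t u|V r t|V|V p IHp q IHq|V s p IHp] a //.
- by rewrite !ev; split=> [/eI|->].
- rewrite -[X in _ <-> X]er.
  suff -> : (fun i => eval (C := B) (fun v => e _ (a v)) (t i)) =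
            (fun i => e _ (eval a (t i))) by [].
  by apply: functional_extensionality_dep => i; rewrite ev.
- by rewrite IHp IHq.
- have ets x : (fun v => e _ (tsnoc a x v)) = tsnoc (C := B) (fun v => e _ (a v)) (e _ x).
    by apply: functional_extensionality_dep; case.
  split=> h x; first by apply/IHp; rewrite ets.
  by have [y <-] := eS _ x; rewrite -ets; apply/IHp.
Qed.

(** * Automorphic images of elementary submodels *)

Section Image.
Variables (L : language) (C : structure L) (h : aut C) (M : elem_sub C).

Definition image_dom s : set (C s) := [set x | dom M s (ainv h x)].
Arguments image_dom : clear implicits.

Lemma image_dom0 s : image_dom s !=set0.
Proof. by have [x Mx] := dom0 M s; exists (h s x); rewrite /image_dom /= afunK. Qed.

Lemma image_dom_closed (f : fsym L) (x : forall i, C (farg i)) :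
  (forall i, image_dom _ (x i)) -> image_dom _ (fint C f x).
Proof.
move=> xM; rewrite /image_dom /=.
have -> : ainv h (fint C f x) = fint C f (fun i => ainv h (x i)) :=
  aut_fint (autV h) f x.
exact: dom_closed.
Qed.

Let ML := substructure (@dom0 L C M) (@dom_closed L C M).
Let hML := substructure image_dom0 image_dom_closed.

Lemma image_mem s (x : ML s) : image_dom s (h s (val x)).
Proof. by rewrite /image_dom /= afunK; exact: set_valP. Qed.

Let e s (x : ML s) : hML s := SigSub (mem_set (image_mem x)).

Lemma image_elem (V : ctx L) (p : formula V) (a : tup V hML) :
  sat p a <-> sat (C := C) p (fun v => \val (a v)).
Proof.
have eS s y : exists x, @e s x = y.
  exists (SigSub (mem_set (set_valP y : dom M s (ainv h (val y))))).
  by apply: val_inj; rewrite /= ainvK.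
pose b : tup V ML := fun v => projT1 (cid (eS _ (a v))).
have ab : a = fun v => e (b v).
  by apply: functional_extensionality_dep => v; rewrite /b; case: cid.
rewrite ab (@sat_iso _ ML hML e _ eS).
- rewrite (@dom_elem _ _ M V p b) -(sat_act h p (fun v => val (b v))).
  by [].
- move=> s x y /(congr1 val)/= /(can_inj (@afunK _ _ h s)); exact: val_inj.
- by move=> f x; apply: val_inj; rewrite /= aut_fint.
- by move=> r x; rewrite /= (aut_rint h r (fun i => val (x i))).
Qed.

Definition image_model : elem_sub C := ElemSub image_elem.

Lemma image_model_small : small_model M -> small_model image_model.
Proof.
have sigI (X Y : lsort L -> Type) (g : forall s, X s -> Y s) :
    (forall s, injective (@g s)) ->
    [set: {s & X s}] #<= [set: {s & Y s}].
  move=> gI; apply/card_setT_leP; exists (fun x => existT _ _ (g _ (projT2 x))).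
  move=> [s x] [t y] /= xy; have st := existT_inj1 xy.
  by case: t / st y xy => y xy; rewrite (gI _ _ _ (existT_inj_tagged xy)).
have eq : [set: image_model] #= [set: M].
  rewrite card_eq_le; apply/andP; split.
    apply: (sigI (fun s => image_dom s) (fun s => dom M s)
      (fun s y => SigSub (mem_set (set_valP y : dom M s (ainv h (val y)))))).
    by move=> s x y /(congr1 val)/= /(can_inj (@ainvK _ _ h s)); exact: val_inj.
  apply: (sigI (fun s => dom M s) (fun s => image_dom s) e).
  by move=> s x y /(congr1 val)/= /(can_inj (@afunK _ _ h s)); exact: val_inj.
by move=> Ms; exact: card_eq_trans eq Ms.
Qed.

End Image.

(** * Lascar equivalence of automorphisms as a group congruence *)

Section LascarGroup.
Variables (L : language) (C : structure L).
Implicit Types (f g h k : aut C) (M N : elem_sub C).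

Lemma actM (V : ctx L) f g (a : tup V C) : act (f * g) a = act f (act g a).
Proof. by []. Qed.

Lemma actK (V : ctx L) f (a : tup V C) : act f^-1 (act f a) = a.
Proof. by rewrite -actM mulVg. Qed.

Lemma actKV (V : ctx L) f (a : tup V C) : act f (act f^-1 a) = a.
Proof. by rewrite -actM mulgV. Qed.

Lemma act_cat (V W : ctx L) f (a : tup V C) (b : tup W C) :
  act f (tcat a b) = tcat (act f a) (act f b).
Proof. by apply: functional_extensionality_dep; case. Qed.

Lemma aut_overP M f : aut_over M f <-> forall s x, dom M s x -> f s x = x.
Proof.
split=> [fM s x xM|fM].
  exact: (congr1 (fun a : tup M C => a (existT _ s (SigSub (mem_set xM)))) fM).
apply: functional_extensionality_dep => -[s x]; apply: fM; exact: set_valP.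
Qed.

Lemma aut_over_conj M f h : aut_over M f -> aut_over (image_model h M) (h * f * h^-1).
Proof.
move=> /aut_overP fM; apply/aut_overP => s x xM.
by rewrite /= [f _ _]fM// ainvK.
Qed.

Section Subgroup.
Variables (H : set (aut C)) (HP : subgroup H).

Lemma subgroup1 : H 1. Proof. by case: HP => /set_mem. Qed.

Lemma subgroupV f : H f -> H f^-1.
Proof. by move=> /mem_set Hf; apply/set_mem; exact: group_closedV. Qed.

Lemma subgroupM f g : H f -> H g -> H (f * g).
Proof.
move=> /mem_set Hf /mem_set Hg; apply/set_mem; exact: (group_closedM HP).
Qed.

End Subgroup.

Let AutfP := @Autf_subgroup L C.

(** Conjugation by [h] takes the generators fixing [M] to generators fixing [h M], so the preimage
    [H] of [Autf] under conjugation is a subgroup containing all generators. *)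
Lemma Autf_conj f h : Autf C f -> Autf C (h * f * h^-1).
Proof.
pose H : set (aut C) := [set f | Autf C (h * f * h^-1)].
move=> /(_ H); apply; split=> [|k [M Ms kM]].
  split=> [|x y /set_mem xH /set_mem yH]; apply/mem_set.
    by change (Autf C (h * 1 * h^-1)); rewrite mulg1 mulgV; exact: (subgroup1 AutfP).
  change (Autf C (h * (x * y^-1) * h^-1)).
  have -> : h * (x * y^-1) * h^-1 = (h * x * h^-1) * (h * y * h^-1)^-1.
    by rewrite !invgM invgK !mulgA mulgVK.
  by apply: (subgroupM AutfP xH); exact: (subgroupV AutfP yH).
move=> G [GP]; apply; exists (image_model h M); [exact: image_model_small|exact: aut_over_conj].
Qed.

Definition lascar f g := Autf C (f^-1 * g).

Lemma lascar_refl f : lascar f f.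
Proof. by rewrite /lascar mulVg; exact: (subgroup1 AutfP). Qed.

Lemma lascar_sym f g : lascar f g -> lascar g f.
Proof. by move=> /(subgroupV AutfP); rewrite /lascar invgM invgK. Qed.

Lemma lascar_trans f g h : lascar f g -> lascar g h -> lascar f h.
Proof.
by move=> fg gh; have := subgroupM AutfP fg gh; rewrite /lascar -mulgA mulVKg.
Qed.

Lemma lascar_mull h f g : lascar f g -> lascar (h * f) (h * g).
Proof. by rewrite /lascar invgM -mulgA mulKg. Qed.

Lemma lascar_mulr h f g : lascar f g -> lascar (f * h) (g * h).
Proof.
move=> /(@Autf_conj _ h^-1); rewrite /lascar invgM invgK !mulgA.
by [].
Qed.

Lemma lascar_mul f f' g g' :
  lascar f f' -> lascar g g' -> lascar (f * g) (f' * g').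
Proof.
by move=> ff gg; exact: lascar_trans (lascar_mulr g ff) (lascar_mull f' gg).
Qed.

Lemma lascar_inv f g : lascar f g -> lascar f^-1 g^-1.
Proof.
move=> fg; have := lascar_mulr g^-1 (lascar_mull f^-1 fg).
by rewrite mulVg mul1g -mulgA mulgV mulg1 => /lascar_sym.
Qed.

Lemma lascar_act M f g : small_model M ->
  act f (enum_of M) = act g (enum_of M) -> lascar f g.
Proof.
move=> Ms fg H [HP]; apply; exists M => //.
by rewrite /aut_over /= actM -fg actK.
Qed.

Lemma lascar_over M h f : small_model M -> aut_over M h -> lascar f (h * f).
Proof.
move=> Ms hM; have : lascar 1 h by apply: (lascar_act Ms); rewrite hM.
by move=> /(lascar_mulr f); rewrite mul1g.
Qed.

Lemma galj_lascar f g : galj f = galj g <-> lascar f g.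
Proof.
rewrite /galj; split=> [/eqmodP|h]; first by rewrite /= /gal_rel => /set_mem.
by apply/eqmodP; rewrite /= /gal_rel; exact: mem_set.
Qed.

End LascarGroup.

(** * The closure of G in the Lascar group *)

Section LimitClass.
Variables (L : language) (T : set (sentence L)) (K : Type) (C : structure L).
Hypothesis CM : monster T K C.
Variable G : set (aut C).
Hypotheses (GP : subgroup G) (AG : Autf C `<=` G).

(** As in [S_set], a type over the parameters [n] is encoded by appending [n] to the tuple. *)
Definition orb (V W : ctx L) (b : tup V C) (n : tup W C) :
    set (tup (ctx_cat V W) C) :=
  [set w | exists2 g, G g & w = tcat (act g b) n].

Definition limit_class (M N : elem_sub C) : set (aut C) :=
  [set f | exists2 f', lascar f f' &
    tcl (orb (enum_of M) (enum_of N)) (tcat (act f' (enum_of M)) (enum_of N))].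

Definition sub_inl (V W : ctx L) : substitution V (ctx_cat V W) :=
  fun v => Var (inl v : ctx_cat V W).
Definition sub_inr (V W : ctx L) : substitution W (ctx_cat V W) :=
  fun v => Var (inr v : ctx_cat V W).
Definition sub_cat (V V' W : ctx L) (σ : substitution V W)
    (τ : substitution V' W) : substitution (ctx_cat V V') W :=
  fun v => match v with inl x => σ x | inr y => τ y end.
Definition sub_comp (V W X : ctx L) (σ : substitution V W)
    (τ : substitution W X) : substitution V X :=
  fun v => term_subst τ (σ v).

Lemma pull_cat (V V' W : ctx L) (σ : substitution V W) (τ : substitution V' W)
  (w : tup W C) : pull (sub_cat σ τ) w = tcat (pull σ w) (pull τ w).
Proof. by apply: functional_extensionality_dep; case. Qed.

Lemma pull_inl (V W : ctx L) (a : tup V C) (b : tup W C) :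
  pull (@sub_inl V W) (tcat a b) = a.
Proof. exact: functional_extensionality_dep. Qed.

Lemma pull_inr (V W : ctx L) (a : tup V C) (b : tup W C) :
  pull (@sub_inr V W) (tcat a b) = b.
Proof. exact: functional_extensionality_dep. Qed.

Lemma tup_cat (V W : ctx L) (w : tup (ctx_cat V W) C) :
  w = tcat (pull (@sub_inl V W) w) (pull (@sub_inr V W) w).
Proof. by apply: functional_extensionality_dep; case. Qed.

Lemma tcat_inj (V W : ctx L) (a a' : tup V C) (b b' : tup W C) :
  tcat a b = tcat a' b' -> a = a' /\ b = b'.
Proof.
move=> ab; split.
- by rewrite -(pull_inl a b) ab pull_inl.
- by rewrite -(pull_inr a b) ab pull_inr.
Qed.

(** The limit is lifted to a limit [(f1 M, N, c, n')] of tuples [(g M, N, g b, n)]. Then [n'] has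
    the type of [n] over [N], and [(f1 M, c)] has the type of [(M, b)]. The automorphisms [h] and
    [k] realizing these equalities change [f1] only within its Lascar class. *)
Lemma limit_class_transfer (M N : elem_sub C) (V W : ctx L) (b : tup V C)
    (n : tup W C) f :
  small_model M -> small_model N -> small V -> small W -> limit_class M N f ->
  exists2 f', lascar f f' & tcl (orb b n) (tcat (act f' b) n).
Proof.
move=> Ms Ns Vs Ws [f1 ff1 f1M].
have Ms' := small_model_small Ms; have Ns' := small_model_small Ns.
pose A : set (tup (ctx_cat (ctx_cat M N) (ctx_cat V W)) C) := [set w |
  exists2 g, G g & w = tcat (tcat (act g (enum_of M)) (enum_of N)) (tcat (act g b) n)].
have [||u [g Gg ->]|w Aw wM] := tcl_lift CM (σ := @sub_inl _ _) (A := A) _ _ _ f1M.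
- exact: small_cat.
- by do !apply: small_cat.
- by exists (tcat (tcat (act g (enum_of M)) (enum_of N)) (tcat (act g b) n));
    [exists g|rewrite pull_inl].
move: Aw wM; rewrite (tup_cat w) pull_inl => + wM; rewrite {}wM.
rewrite (tup_cat (pull _ w)); set c := pull _ (pull _ w); set n' := pull _ (pull _ w).
move=> Aw.
have tpn : tp (tcat (enum_of N) n') = tp (tcat (enum_of N) n).
  have := @tcl_tp_const _ _ _ _ (sub_cat (sub_comp (@sub_inr M N) (@sub_inl _ _))
    (sub_comp (@sub_inr V W) (@sub_inr _ _))) A _ (tcat (enum_of N) n) _ Aw.
  by rewrite pull_cat; apply=> _ [g _ ->]; rewrite pull_cat.
have tpc : tp (tcat (enum_of M) b) = tp (tcat (act f1 (enum_of M)) c).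
  have := @tcl_tp_const _ _ _ _ (sub_cat (sub_comp (@sub_inl M N) (@sub_inl _ _))
    (sub_comp (@sub_inl V W) (@sub_inr _ _))) A _ (tcat (enum_of M) b) _ Aw.
  rewrite pull_cat => <- // _ [g _ ->].
  by rewrite pull_cat -(tp_act g (tcat (enum_of M) b)) act_cat.
have [h [hN hn]] := homogeneous2 CM Ns' Ws tpn.
have [k [kM kb]] := homogeneous2 CM Ms' Vs tpc.
(* [h] fixes [N], and [k] agrees with [f1] on [M]. *)
exists (h * k).
  apply: lascar_trans (lascar_over _ Ns hN) .
  apply: lascar_trans ff1 _; exact: (lascar_act Ms).
rewrite actM kb -{2}hn -act_cat.
apply: (@tcl_tp _ _ _ _ (tcat c n')); first by rewrite tp_act.
have := @tcl_pull _ _ _ _ (@sub_inr _ _) A (orb b n) _ _ Aw.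
rewrite pull_inr; apply=> _ [g Gg ->]; rewrite pull_inr.
by apply: subset_tcl; exists g.
Qed.

Lemma limit_class_change (M N M' N' : elem_sub C) f :
  small_model M -> small_model N -> small_model M' -> small_model N' ->
  limit_class M N f -> limit_class M' N' f.
Proof.
move=> Ms Ns Ms' Ns'; apply: limit_class_transfer => //; exact: small_model_small.
Qed.

Lemma limit_class_lascar M N f g :
  lascar f g -> limit_class M N f -> limit_class M N g.
Proof.
move=> fg [f' ff' fM]; exists f' => //; exact: lascar_trans (lascar_sym fg) ff'.
Qed.

Lemma sub_limit_class M N : G `<=` limit_class M N.
Proof.
move=> g Gg; exists g; first exact: lascar_refl.
by apply: subset_tcl; exists g.
Qed.

(** With [N] replaced by [M], inversion exchanges the two halves of [(f M, M)] up to an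
    automorphism, and so preserves limits. *)
Lemma limit_classV M N f :
  small_model M -> small_model N -> limit_class M N f -> limit_class M N f^-1.
Proof.
move=> Ms Ns /(limit_class_change Ms Ns Ms Ms)[f' ff' fM].
apply: (limit_class_change Ms Ms Ms Ns).
exists f'^-1; first exact: lascar_inv.
move=> p pG.
have swapE (b c : tup M C) : pull (sub_cat (@sub_inr M M) (@sub_inl M M)) (tcat b c) = tcat c b.
  by rewrite pull_cat.
have swap g : sat p (tcat (act g^-1 (enum_of M)) (enum_of M)) <->
    sat (formula_subst p (sub_cat (@sub_inr M M) (@sub_inl M M)))
      (tcat (act g (enum_of M)) (enum_of M)).
  by rewrite sat_subst swapE -(sat_act g) act_cat actKV.
apply/swap/fM => _ [g Gg ->]; apply/swap/pG.
by exists g^-1 => //; exact: subgroupV.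
Qed.

(** Take [h M] near [f' M] over [N] and [k M] near [g' M] over [M]. The pair [(h k M, h M)] has the
    type of [(k M, M)], so a limit of the triples [(h k M, h M, N)] gives [x] with [(x, f' M)] of
    the type of [(g' M, M)]. This makes [x] the image of [M] under a product in the class of
    [f * g]. *)
Lemma limit_classM M N f g : small_model M -> small_model N ->
  limit_class M N f -> limit_class M N g -> limit_class M N (f * g).
Proof.
move=> Ms Ns [f' ff' fM] /(limit_class_change Ms Ns Ms Ms)[g' gg' gM].
have Ms' := small_model_small Ms; have Ns' := small_model_small Ns.
pose A : set (tup (ctx_cat M (ctx_cat M N)) C) := [set w | exists h g,
  [/\ G h, G g & w = tcat (act (h * g) (enum_of M))
    (tcat (act h (enum_of M)) (enum_of N))]].
pose τ : substitution (ctx_cat M M) (ctx_cat M (ctx_cat M N)) :=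
  sub_cat (@sub_inl _ _) (sub_comp (@sub_inl _ _) (@sub_inr _ _)).
have τE (x y : tup M C) (z : tup N C) :
    pull τ (tcat x (tcat y z)) = tcat x y by exact: pull_cat.
have [|||w [Aw]] := @tcl_lift2 _ _ _ _ CM _ _ _ (@sub_inr _ _) τ A
  (tcat (act f' (enum_of M)) (enum_of N)) (tcat (act g' (enum_of M)) (enum_of M)).
- exact: small_cat.
- by do !apply: small_cat.
- move=> p q /(tcl_meets fM)[_ [h Gh ->] ph] /(tcl_meets gM)[_ [k Gk ->] qk].
  exists (tcat (act (h * k) (enum_of M)) (tcat (act h (enum_of M)) (enum_of N))).
  split; [by exists h, k|by rewrite pull_inr|].
  by rewrite τE actM -act_cat; apply/sat_act.
move: Aw; rewrite (tup_cat w) pull_inr; set x := pull _ w.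
move=> + wM; rewrite {}wM τE => Aw /esym/(homogeneous2 CM Ms' Ms')[k [kx kM]].
exists (k * g').
  by apply: lascar_mul gg'; apply: lascar_trans ff' _; apply: (lascar_act Ms).
rewrite actM kx.
have := @tcl_pull _ _ _ _ (sub_cat (@sub_inl _ _) (sub_comp (@sub_inr _ _) (@sub_inr _ _)))
  A (orb (enum_of M) (enum_of N)) _ _ Aw.
rewrite pull_cat; apply=> _ [h [k' [Gh Gk ->]]]; rewrite pull_cat.
by apply: subset_tcl; exists (h * k') => //; exact: subgroupM.
Qed.

(* A limit [f0] of [f = f' * k] factors as [f1 * f1^-1 * f0], where [f1] is a
   limit of the [f'] and [f1^-1 * f0] a limit of the [k] in [Autf]. *)
Lemma limit_class_closed M N f0 : small_model M -> small_model N ->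
  tcl [set w | exists2 f, limit_class M N f &
         w = tcat (act f (enum_of M)) (enum_of N)]
    (tcat (act f0 (enum_of M)) (enum_of N)) ->
  limit_class M N f0.
Proof.
move=> Ms Ns f0M.
have Ms' := small_model_small Ms; have Ns' := small_model_small Ns.
pose A : set (tup (ctx_cat M (ctx_cat M N)) C) := [set w | exists f f',
  [/\ lascar f f',
    tcl (orb (enum_of M) (enum_of N)) (tcat (act f' (enum_of M)) (enum_of N)) &
    w = tcat (act f (enum_of M)) (tcat (act f' (enum_of M)) (enum_of N))]].
pose σ : substitution (ctx_cat M N) (ctx_cat M (ctx_cat M N)) :=
  sub_cat (@sub_inl _ _) (sub_comp (@sub_inr _ _) (@sub_inr _ _)).
pose τ : substitution (ctx_cat M M) (ctx_cat M (ctx_cat M N)) :=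
  sub_cat (@sub_inl _ _) (sub_comp (@sub_inl _ _) (@sub_inr _ _)).
have σE (x y : tup M C) (z : tup N C) :
    pull σ (tcat x (tcat y z)) = tcat x z by exact: pull_cat.
have τE (x y : tup M C) (z : tup N C) :
    pull τ (tcat x (tcat y z)) = tcat x y by exact: pull_cat.
have [|||w] := @tcl_lift _ _ _ _ CM _ _ σ A _ _ _ _ _ f0M.
- exact: small_cat.
- by do !apply: small_cat.
- move=> _ [f [f' ff' fM] ->].
  by exists (tcat (act f (enum_of M)) (tcat (act f' (enum_of M)) (enum_of N)));
    [exists f, f'|rewrite σE].
rewrite (tup_cat w) (tup_cat (pull (@sub_inr _ _) w)) σE.
set x := pull _ w; set y := pull _ _; set z := pull _ (pull _ w).
move=> + /tcat_inj[xE zE]; rewrite {}xE {}zE => Aw {x z}.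
have yM : tcl (orb (enum_of M) (enum_of N)) (tcat y (enum_of N)).
  have := @tcl_pull _ _ _ _ (@sub_inr _ _) A (orb (enum_of M) (enum_of N)) _ _ Aw.
  by rewrite pull_inr; apply=> _ [f [f' [_ fM ->]]]; rewrite pull_inr.
(* As a limit of conjugates of [M], the tuple [y] has the type of [M]. *)
have [f1 f1y] : exists f1 : aut C, act f1 (enum_of M) = y.
  apply: (homogeneous CM (small_lt CM Ms')).
  have := @tcl_tp_const _ _ _ _ (@sub_inl _ _) _ _ (enum_of M) _ yM.
  rewrite pull_inl => -> // _ [g _ ->]; rewrite pull_inl; exact: tp_act.
rewrite -f1y in yM Aw.
have f1M : limit_class M N f1 by exists f1 => //; exact: lascar_refl.
have kM : limit_class M N (f1^-1 * f0).
  apply: (limit_class_change Ms Ms Ms Ns).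
  exists (f1^-1 * f0); first exact: lascar_refl.
  (* Moved by [f1], the pair to study is [(f0 M, f1 M)], a limit of pairs [(f M, f' M)]. Each of
     these has the type of [(f'^-1 f M, M)], where [f'^-1 f] lies in [Autf] and hence in [G]. *)
  move=> p pG; apply/(sat_act f1); rewrite act_cat actM actKV.
  rewrite -(τE _ _ (enum_of N)); apply/sat_subst/Aw => _ [f [f' [ff' _ ->]]].
  apply/sat_subst; rewrite τE -[act f _](actKV f') -act_cat.
  apply/sat_act/pG; exists (f'^-1 * f) => //.
  by apply: AG; exact: lascar_sym.
by rewrite -[f0](mulVKg f1); exact: limit_classM.
Qed.

Lemma limit_classP M N f : small_model M -> small_model N ->
  limit_class M N f <->
  tcl [set w | exists2 f, limit_class M N f &
         w = tcat (act f (enum_of M)) (enum_of N)]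
    (tcat (act f (enum_of M)) (enum_of N)).
Proof.
move=> Ms Ns; split=> [fM|]; last exact: limit_class_closed.
by apply: subset_tcl; exists f.
Qed.

End LimitClass.

(** * The topological closure, and part (i) *)

Section Closure.
Variables (L : language) (T : set (sentence L)) (K : Type) (C : structure L).
Hypothesis CM : monster T K C.
Variable G : set (aut C).
Hypotheses (GP : subgroup G) (AG : Autf C `<=` G).
Variables M N : elem_sub C.
Hypotheses (Ms : small_model M) (Ns : small_model N).

Let Ms' := small_model_small Ms.
Let Ns' := small_model_small Ns.

Lemma mu_lascar f g : mu M N f = mu M N g -> lascar f g.
Proof.
move=> /(congr1 val)/= /(homogeneous2 CM Ms' Ns')[h [hf hN]].
apply: lascar_trans (lascar_over f Ns hN) _.
by apply: (lascar_act Ms).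
Qed.

Lemma nu_mu f : nu (mu M N f) = galj f.
Proof.
apply/galj_lascar; apply: mu_lascar.
(* The default of [xget] does not occur, as [f] itself is a preimage; [mu_lascar] makes the chosen
   preimage irrelevant. *)
by case: xgetP => [g _ ->//|/(_ f)]; case.
Qed.

Lemma mu_surj (q : S_MN M N) : exists f, q = mu M N f.
Proof.
have [a aM qa] := set_valP q.
have [f fM] := homogeneous CM (small_lt CM Ms') (esym aM).
by exists f; apply: val_inj; rewrite qa /= fM.
Qed.

Lemma open_nu_limit_class :
  open (~` (@galj L C @` limit_class G M N) : set (GalTop M N)).
Proof.
change (open (@nu _ _ M N @^-1` (~` (@galj L C @` limit_class G M N)))).
(* [O] is the complement of the closure of the types of [(f M, N)] with [f] in the limit class; by
   [limit_class_closed], this closure meets [S_M(N)] in those types only. *)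
pose O : set (stype C (ctx_cat M N)) := [set q | exists2 p, in_type q p &
  forall f, limit_class G M N f -> ~ sat p (tcat (act f (enum_of M)) (enum_of N))].
have Oo : open O by move=> q [p qp pX]; exists p => // r rp; exists p.
have -> : @nu _ _ M N @^-1` (~` (@galj L C @` limit_class G M N)) = val @^-1` O.
  apply/seteqP; split=> q; have [f ->] := mu_surj q; rewrite /preimage /= nu_mu.
  - move=> nf; apply: contrapT => nO; apply: nf; exists f => //.
    apply: (limit_class_closed CM GP AG Ms Ns) => // p pX; apply: contrapT => np; apply: nO.
    exists (Neg p) => // g gX; rewrite sat_Neg; apply; apply: pX.
    by exists g.
  - move=> [p pf pX] [g gX /galj_lascar gf]; apply: (pX f) pf.
    exact: limit_class_lascar gf gX.
by exists O.
Qed.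

(** The limit class induces a closed set containing the image of [G]. Conversely, a neighbourhood of
    the class of [f'] contains the classes given by some formula true of [(f' M, N)], and that
    formula holds of [(g M, N)] for some [g] in [G]. *)
Lemma jclE : jcl M N G = limit_class G M N.
Proof.
apply/seteqP; split=> f.
- move=> fG; have : closure (@galj L C @` limit_class G M N : set (GalTop M N)) (galj f).
    by apply: closure_subset fG; apply: image_subset; exact: sub_limit_class.
  rewrite -(closure_id _).1; last by rewrite -openC; exact: open_nu_limit_class.
  by move=> [g gX /galj_lascar gf]; exact: limit_class_lascar gf gX.
- move=> [f' /galj_lascar ff' fM]; rewrite /jcl /preimage /= ff' => U.
  rewrite nbhsE => -[B [Bo Bf] BU].
  have [O Oo OB] : open (@nu _ _ M N @^-1` B) by exact: Bo.
  have /Oo[p pf pO] : O (val (mu M N f')).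
    by have : (val @^-1` O) (mu M N f') by rewrite OB /preimage /= nu_mu.
  have [_ [g Gg ->] pg] := tcl_meets fM pf.
  exists (galj g); split; first by exists g.
  by apply: BU; rewrite -nu_mu -[B _]/((@nu _ _ M N @^-1` B) _) -OB; exact: pO.
Qed.

Lemma jcl_subgroup : subgroup (jcl M N G).
Proof.
rewrite jclE; split=> [|f g /set_mem fX /set_mem gX]; apply/mem_set.
  by apply: sub_limit_class; exact: subgroup1.
apply: (limit_classM CM GP) => //; exact: (limit_classV CM GP).
Qed.

Lemma sub_jcl : G `<=` jcl M N G.
Proof. by rewrite jclE; exact: sub_limit_class. Qed.

Section OrbitRelation.
Variable k : ctx L.
Hypothesis ks : small k.
Let E : krel k C := orbit_rel k (jcl M N G).

Lemma orbit_rel_equivalence (H : set (aut C)) : subgroup H -> equivalence (orbit_rel k H).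
Proof.
move=> HP; split.
- by move=> a; exists 1; [exact: subgroup1|].
- by move=> a b [f Hf ->]; exists f^-1; [exact: subgroupV|rewrite actK].
- by move=> a b c [f Hf ->] [g Hg ->]; exists (f * g); [exact: subgroupM|].
Qed.

(** An automorphism fixing [M] lies in [Autf], hence in [G]. This gives boundedness here and
    thickness in [Theta_sub]. *)
Lemma orbit_rel_over a b :
  tp (tcat a (enum_of M)) = tp (tcat b (enum_of M)) -> E a b.
Proof.
move=> /esym/(homogeneous2 CM ks Ms')[f [fb fM]]; exists f => //.
by apply/sub_jcl/AG => H [_]; apply; exists M.
Qed.

(** A class is determined by a type over [M], and there are at most [2^|T|] of these. *)
Lemma orbit_rel_bounded : bounded K E.
Proof.
have [E1 E2 E3] := orbit_rel_equivalence jcl_subgroup.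
pose t (a : tup k C) := [set p | sat p (tcat a (enum_of M))].
pose h (P : set (formula (ctx_cat k M))) := [set b | exists2 a, t a = P & E a b].
have hE : range (fun a => [set b | E a b]) = h @` range t.
  rewrite image_comp; apply: eq_imagel => a _; apply/seteqP; split=> b /=.
    by exists a.
  move=> [a' aa']; apply: E3; apply: orbit_rel_over.
  by apply/stypeP; rewrite /= -/(t a) -/(t a').
have [le nle] : card_lt [set: set (all_formulas L)] [set: K] by case: CM.
have le' : range (fun a => [set b | E a b]) #<= [set: set (all_formulas L)].
  rewrite hE; apply: card_le_trans (card_image_le _ _) _.
  apply: card_le_trans (card_leT _) _; apply: card_le_powerset.
  by apply: formula_le; exact: small_cat.
split; first exact: card_le_trans le' le.
by move=> Kle; apply: nle; exact: card_le_trans Kle le'.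
Qed.

(* [E a b] iff some [m] satisfies [tp (m, a) = tp (M, b)] and [(m, M)] is
   a limit of pairs [(f M, M)] with [f] in the closure of [G]. *)
Definition orbit_graph : set (tup (ctx_cat (ctx_cat k k) M) C) :=
  [set w | exists a b m n, [/\ w = tcat (tcat a b) n,
     tp (tcat m a) = tp (tcat n b) &
     tcl [set w | exists2 f, limit_class G M M f &
            w = tcat (act f (enum_of M)) (enum_of M)] (tcat m n)]].

Lemma orbit_graphP a b : E a b <-> orbit_graph (tcat (tcat a b) (enum_of M)).
Proof.
have jE : jcl M N G = limit_class G M M.
  by rewrite jclE; apply/seteqP; split=> f; exact: (limit_class_change CM).
rewrite /E jE; split.
- move=> [f fX ->]; exists (act f b), b, (act f (enum_of M)), (enum_of M).
  split=> //; first by rewrite -act_cat tp_act.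
  exact: (limit_classP CM GP AG f Ms Ms).1.
- move=> [a' [b' [m [n [/tcat_inj[/tcat_inj[<- <-] <-] mab mM]]]]].
  have [f [fM fb]] := homogeneous2 CM Ms' ks (esym mab).
  exists f => //; apply/(limit_classP CM GP AG f Ms Ms).
  by rewrite fM.
Qed.

(** With the witness [m] as an extra coordinate, both conditions on it are closed, by [tcl_tp_eq]
    and [tcl_pull]. The graph is a projection of the resulting set, and [tcl_lift] applies. *)
Lemma orbit_graph_closed : tcl orbit_graph `<=` orbit_graph.
Proof.
move=> w0 w0P.
pose X := ctx_cat (ctx_cat (ctx_cat k k) M) M.
pose A : set (tup X C) := [set w | exists a b m n, [/\
     w = tcat (tcat (tcat a b) n) m,
     tp (tcat m a) = tp (tcat n b) &
     tcl [set w | exists2 f, limit_class G M M f &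
            w = tcat (act f (enum_of M)) (enum_of M)] (tcat m n)]].
have [|||w Aw ww0] := @tcl_lift _ _ _ _ CM _ _ (@sub_inl _ _ _) A _ _ _ _ _ w0P.
- by do !apply: small_cat.
- by do !apply: small_cat.
- move=> _ [a [b [m [n [-> mn mX]]]]].
  by exists (tcat (tcat (tcat a b) n) m); [exists a, b, m, n|rewrite pull_inl].
rewrite -ww0; set u := pull _ w; set m := pull (@sub_inr _ _ _) w.
have wE : w = tcat u m by exact: tup_cat.
clearbody u m; subst w => {ww0 w0P}.
rewrite (tup_cat u) (tup_cat (pull (@sub_inl _ _ _) u)) in Aw *.
move: Aw; set a := pull _ (pull _ u); set b := pull _ (pull _ u); set n := pull _ u.
clearbody a b n => Aw; exists a, b, m, n; split=> //.
- pose σ : substitution (ctx_cat M k) X := sub_cat (@sub_inr _ _ _)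
    (sub_comp (sub_comp (@sub_inl _ _ _) (@sub_inl _ _ _)) (@sub_inl _ _ _)).
  pose τ : substitution (ctx_cat M k) X := sub_cat
    (sub_comp (@sub_inr _ _ _) (@sub_inl _ _ _))
    (sub_comp (sub_comp (@sub_inr _ _ _) (@sub_inl _ _ _)) (@sub_inl _ _ _)).
  have σE (a' b' : tup k C) (n' m' : tup M C) :
      pull σ (tcat (tcat (tcat a' b') n') m') = tcat m' a'. by exact: pull_cat.
  have τE (a' b' : tup k C) (n' m' : tup M C) :
      pull τ (tcat (tcat (tcat a' b') n') m') = tcat n' b'. by exact: pull_cat.
  rewrite -(σE a b n m) -(τE a b n m); apply: tcl_tp_eq Aw.
  by move=> _ [a' [b' [m' [n' [-> mn _]]]]]; rewrite σE τE.
- pose σ : substitution (ctx_cat M M) X := sub_cat (@sub_inr _ _ _)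
    (sub_comp (@sub_inr _ _ _) (@sub_inl _ _ _)).
  have σE (a' b' : tup k C) (n' m' : tup M C) :
      pull σ (tcat (tcat (tcat a' b') n') m') = tcat m' n'. by exact: pull_cat.
  rewrite -(σE a b n m); apply: tcl_pull Aw.
  by move=> _ [a' [b' [m' [n' [-> _ mn]]]]]; rewrite σE.
Qed.

Lemma orbit_rel_definable : type_definable_over M E.
Proof.
exists [set p | forall w, orbit_graph w -> sat p w] => a b.
rewrite orbit_graphP; split=> [h p|h]; first exact.
by apply: orbit_graph_closed => p; exact: h.
Qed.

(** The limit is transferred to [b] over the parameters [(b, M')]. The formulas defining [F] hold of
    all [(g b, b)], so they hold of [(f' b, b)]; and [f b] is related to [f' b] through an element
    of [Autf]. *)
Lemma orbit_rel_finest (F : krel k C) (M' : elem_sub C) :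
  equivalence F -> small_model M' -> type_definable_over M' F ->
  rel_incl (orbit_rel k G) F -> rel_incl E F.
Proof.
move=> [_ Fs Ft] Ms1 [P PF] GF _ b [f fX ->]; rewrite jclE in fX.
have Ms1' := small_model_small Ms1.
have [f' ff' fb] := limit_class_transfer CM b (tcat b (enum_of M')) Ms Ns ks
  (small_cat ks Ms1') fX.
apply: (Ft _ (act f' b)).
  apply: GF; exists (f * f'^-1); last by rewrite actM actK.
  apply: AG; have := lascar_sym (lascar_mulr f'^-1 ff').
  by rewrite mulgV /lascar invg1 mul1g.
apply/PF => p Pp.
pose σ : substitution (ctx_cat (ctx_cat k k) M') (ctx_cat k (ctx_cat k M')) :=
  sub_cat (sub_cat (@sub_inl _ _ _) (sub_comp (@sub_inl _ _ _) (@sub_inr _ _ _)))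
    (sub_comp (@sub_inr _ _ _) (@sub_inr _ _ _)).
have σE (x y : tup k C) (z : tup M' C) : pull σ (tcat x (tcat y z)) = tcat (tcat x y) z.
  by rewrite /σ !pull_cat.
rewrite -σE; apply/sat_subst/fb => _ [g Gg ->]; apply/sat_subst; rewrite σE.
by move: p Pp; apply/PF/GF; exists g.
Qed.

End OrbitRelation.
End Closure.

(** * Thick formulas and the normal case *)

(** The head [x] splits the tail by [r x], and one part is long enough for a smaller instance.
    Subsequences retain the order of indices that thickness refers to. *)
Lemma ramsey (n m : nat) : exists N, forall (r : rel nat) (s : seq nat),
  (N <= size s)%N ->
  (exists t, [/\ subseq t s, size t = n & pairwise r t]) \/
  (exists t, [/\ subseq t s, size t = m & pairwise (fun i j => ~~ r i j) t]).
Proof.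
elim: n m => [|n IHn] m.
  by exists 0%N => r s _; left; exists [::]; split=> //; exact: sub0seq.
elim: m => [|m [N2 N2P]].
  by exists 0%N => r s _; right; exists [::]; split=> //; exact: sub0seq.
have [N1 N1P] := IHn m.+1.
exists (N1 + N2).+1 => r [|x s] //= Ns.
have sub (P : pred nat) (t : seq nat) : subseq t (seq.filter P s) -> subseq t s.
  by move=> h; exact: subseq_trans h (filter_subseq _ _).
have [le1|lt1] := leqP N1 (size (seq.filter (r x) s)).
  have [[t [ts tn tr]]|[t [ts tm tr]]] := N1P r _ le1; last first.
    by right; exists t; split=> //; apply: subseq_trans (subseq_cons s x); exact: sub ts.
  left; exists (x :: t); split; rewrite /= ?eqxx ?tn //; first exact: sub ts.
  rewrite tr andbT; apply/allP => y /(mem_subseq ts).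
  by rewrite mem_filter => /andP[].
have le2 : (N2 <= size (seq.filter (predC (r x)) s))%N.
  move: Ns lt1; rewrite !size_filter -(count_predC (r x) s) ltnS => h1 h2.
  by rewrite -(leq_add2l N1); apply: leq_trans h1 _; rewrite leq_add2r ltnW.
have [[t [ts tn tr]]|[t [ts tm tr]]] := N2P r _ le2.
  by left; exists t; split=> //; apply: subseq_trans (subseq_cons s x); exact: sub ts.
right; exists (x :: t); split; rewrite /= ?eqxx ?tm //; first exact: sub ts.
rewrite tr andbT; apply/allP => y /(mem_subseq ts).
by rewrite mem_filter => /andP[].
Qed.

Section Thick.
Variables (L : language) (T : set (sentence L)) (K : Type) (C : structure L).
Hypothesis CM : monster T K C.
Variable k : ctx L.
Hypothesis ks : small k.

Lemma thick_Top : thick C (Top (ctx_cat k k)).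
Proof.
split=> //; exists 2%N => a; exists ord0, ord_max; split=> //.
Qed.

(** Pairs are coloured by [p]. A subsequence of length [np] avoiding [p] is impossible, so there is
    one of length [nq] on which [p] holds throughout, and [q] holds at one of its pairs. *)
Lemma thick_And (p q : formula (ctx_cat k k)) :
  thick C p -> thick C q -> thick C (And p q).
Proof.
move=> [ps [np pn]] [qs [nq qn]]; split.
  by move=> a b /sat_And[/ps ? /qs ?]; exact/sat_And.
have [N NP] := ramsey nq np; exists N => a.
pose r (i j : nat) := `[< exists oi oj : 'I_N,
  [/\ oi = i :> nat, oj = j :> nat & sat p (tcat (a oi) (a oj))] >].
have tN t (i : nat) : subseq t (iota 0 N) -> (i < size t)%N -> (nth 0%N t i < N)%N.
  by move=> ts it; have := mem_subseq ts (mem_nth 0%N it); rewrite mem_iota.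
have tlt t (i j : nat) : subseq t (iota 0 N) -> (j < size t)%N -> (i < j)%N ->
    (nth 0%N t i < nth 0%N t j)%N.
  move=> ts jt ij; have : pairwise ltn t.
    apply: subseq_pairwise ts _; rewrite -sorted_pairwise; last exact: ltn_trans.
    exact: iota_ltn_sorted.
  by move=> /(pairwiseP 0%N); apply=> //; rewrite inE; exact: ltn_trans jt.
have szN : (N <= size (iota 0 N))%N by rewrite size_iota.
have [[t [ts tn tr]]|[t [ts tn tr]]] := NP r _ szN.
- have lt (i : 'I_nq) : (nth 0%N t i < N)%N by apply: tN => //; rewrite tn.
  have [i [l [il qil]]] := qn (fun i => a (Ordinal (lt i))).
  have lt' : (l < size t)%N by rewrite tn.
  exists (Ordinal (lt i)), (Ordinal (lt l)); split; first exact: tlt.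
  apply/sat_And; split=> //.
  have /asboolP[oi [ol [ei el pil]]] : r (nth 0%N t i) (nth 0%N t l).
    by move: tr => /(pairwiseP 0%N); apply=> //; rewrite inE; exact: ltn_trans lt'.
  suff [-> ->] : Ordinal (lt i) = oi /\ Ordinal (lt l) = ol by [].
  by split; apply: val_inj; rewrite /= ?ei ?el.
- have lt (i : 'I_np) : (nth 0%N t i < N)%N by apply: tN => //; rewrite tn.
  have [i [l [il pil]]] := pn (fun i => a (Ordinal (lt i))).
  have lt' : (l < size t)%N by rewrite tn.
  have /asboolP[] : ~~ r (nth 0%N t i) (nth 0%N t l).
    by move: tr => /(pairwiseP 0%N); apply=> //; rewrite inE; exact: ltn_trans lt'.
  by exists (Ordinal (lt i)), (Ordinal (lt l)).
Qed.

(* A long sequence contains two tuples agreeing on any finite set of formulas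
   over [M]. *)
Lemma thick_over (M : elem_sub C) (p : formula (ctx_cat k k)) :
  small M ->
  (forall a b, sat p (tcat a b) -> sat (C := C) p (tcat b a)) ->
  (forall a b : tup k C, tp (tcat a (enum_of M)) = tp (tcat b (enum_of M)) ->
     sat p (tcat a b)) ->
  thick C p.
Proof.
move=> Ms ps pM; split=> //; apply: contrapT => nthick.
have {}nthick n : exists a : 'I_n -> tup k C, forall i l : 'I_n,
    (i < l)%N -> ~ sat p (tcat (a i) (a l)).
  apply: contrapT => na; apply: nthick; exists n => a.
  apply: contrapT => nil; apply: na; exists a => i l il pil; apply: nil.
  by exists i, l.
pose W := ctx_cat (ctx_cat k k) M.
pose σ1 : substitution (ctx_cat k M) W := sub_cat
  (sub_comp (@sub_inl _ _ _) (@sub_inl _ _ _)) (@sub_inr _ _ _).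
pose σ2 : substitution (ctx_cat k M) W := sub_cat
  (sub_comp (@sub_inr _ _ _) (@sub_inl _ _ _)) (@sub_inr _ _ _).
have σ1E (x y : tup k C) (z : tup M C) :
    pull σ1 (tcat (tcat x y) z) = tcat x z. by exact: pull_cat.
have σ2E (x y : tup k C) (z : tup M C) :
    pull σ2 (tcat (tcat x y) z) = tcat y z. by exact: pull_cat.
(* Implications in one direction suffice in the limit, where [l] ranges over all finite lists,
   because types are complete. *)
pose agree (l : seq (formula (ctx_cat k M))) : formula W :=
  foldr (fun χ q => And (Imp (formula_subst χ σ1) (formula_subst χ σ2)) q)
    (Top W) l.
pose np : formula W := formula_subst (Neg p) (@sub_inl _ _ _).
have [|||||w wP wM] := @compactness_over _ _ _ _ CM M W (@sub_inr _ _ _) (enum_of M)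
    [set And np (agree l) | l in setT].
- by [].
- by do !apply: small_cat.
- by exists (And np (agree [::])), [::].
- move=> _ _ [l1 _ <-] [l2 _ <-]; exists (And np (agree (l1 ++ l2))).
    by exists (l1 ++ l2).
  move=> w /sat_And[wn wl].
  suff [h1 h2] : sat (agree l1) w /\ sat (agree l2) w by split; exact/sat_And.
  elim: l1 wl => [|χ l1 IH] wl; first by split=> //; exact: sat_Top.
  have /sat_And[h1 /IH[h2 h3]] : sat (And (Imp (formula_subst χ σ1)
    (formula_subst χ σ2)) (agree (l1 ++ l2))) w := wl.
  by split=> //; exact/sat_And.
- move=> _ [l _ <-].
  (* One more tuple than there are truth vectors for [l], so two tuples agree on [l]. *)
  have [a aP] := nthick (2 ^ size l).+1%N.
  pose F i : (size l).-tuple bool :=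
    [tuple `[< sat (nth (Top _) l j) (tcat (a i) (enum_of M)) >] | j < size l].
  have nF : ~ injective F.
    move=> /leq_card; rewrite card_ord card_tuple card_bool ltnn.
    by [].
  have [i [j [ij Fij]]] : exists i j : 'I_(2 ^ size l).+1%N, (i < j)%N /\ F i = F j.
    apply: contrapT => n; apply: nF => i j Fij; apply: val_inj; apply: contrapT => ij.
    by case: (ltngtP i j) ij => // h _; apply: n; [exists i, j|exists j, i].
  exists (tcat (tcat (a i) (a j)) (enum_of M)); last by rewrite pull_inr.
  apply/sat_And; split; first by apply/sat_subst; rewrite pull_inl; exact: aP.
  have {}Fij (m : 'I_(size l)) : sat (nth (Top _) l m) (tcat (a i) (enum_of M)) ->
      sat (nth (Top _) l m) (tcat (a j) (enum_of M)).
    have := congr1 (fun t => tnth t m) Fij; rewrite !tnth_mktuple.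
    by move=> e /asboolP; rewrite e => /asboolP.
  have {}Fij m : (m < size l)%N -> sat (nth (Top _) l m) (tcat (a i) (enum_of M)) ->
      sat (nth (Top _) l m) (tcat (a j) (enum_of M)).
    by move=> ml; exact: (Fij (Ordinal ml)).
  move: (a i) (a j) Fij => x y {F nF aP ij i j a} Fij.
  elim: l Fij => [|χ l IH] Fij; first exact: sat_Top.
  apply/sat_And; split.
    by move=> /sat_subst; rewrite σ1E => h; apply/sat_subst; rewrite σ2E; exact: (Fij 0%N).
  by apply: IH => m ml; exact: (Fij m.+1).
move: wP; rewrite (tup_cat w) wM (tup_cat (pull _ w)).
set x := pull _ (pull _ w); set y := pull _ (pull _ w) => wP.
have /sat_And[/sat_subst + _] : sat (And np (agree [::])) (tcat (tcat x y) (enum_of M)).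
  by apply: wP; exists [::].
rewrite pull_inl; apply; apply: pM; apply: tpP => χ xχ.
have /sat_And[_ /sat_And[h _]] : sat (And np (agree [:: χ])) (tcat (tcat x y) (enum_of M)).
  by apply: wP; exists [:: χ].
by rewrite -(σ2E x); apply/sat_subst/h/sat_subst; rewrite σ1E.
Qed.

End Thick.

Lemma closure_relP (L : language) (C : structure L) (k : ctx L) (E : krel k C) a b :
  closure_rel E a b <->
  tcl [set w | exists c d, E c d /\ w = tcat c d] (tcat a b).
Proof.
split=> [ab p pE|ab U].
  apply: contrapT => np.
  pose O : set (stype C (ctx_cat k k)) := [set q | in_type q (Neg p)].
  have Oo : open O by move=> q qO; exists (Neg p).
  have [|q [[c [d [cd ->]]]]] := ab O; first exact: open_nbhs_nbhs.
  by apply; apply: pE; exists c, d.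
rewrite nbhsE => -[B [Bo Bab] BU].
have [p pab pB] := Bo _ Bab.
have [_ [c [d [cd ->]]] pcd] := tcl_meets ab pab.
by exists (tp (tcat c d)); split; [exists c, d|exact/BU/pB].
Qed.

(** * Normal subgroups, and part (ii) *)

Section Normal.
Variables (L : language) (T : set (sentence L)) (K : Type) (C : structure L).
Hypothesis CM : monster T K C.
Variable G : set (aut C).
Hypotheses (GN : normal_subgroup G) (AG : Autf C `<=` G).
Variables M N : elem_sub C.
Hypotheses (Ms : small_model M) (Ns : small_model N).
Variable k : ctx L.
Hypothesis ks : small k.

Let GP : subgroup G := GN.1.
Let Ms' := small_model_small Ms.
Let Ns' := small_model_small Ns.
Let E : krel k C := orbit_rel k (jcl M N G).

Lemma normal_conj g h : G g -> G (h * g * h^-1).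
Proof. by move=> /(GN.2 _ h^-1); rewrite conjgE invgK mulgA. Qed.

(** Transferred to [h M] and [h N], the limit is carried by [h^-1] to one over [M] and [N];
    normality keeps the approximating elements in [G]. *)
Lemma jcl_conj f h : jcl M N G f -> jcl M N G (h^-1 * f * h).
Proof.
rewrite !(jclE CM) // => fX.
have [f' ff' fM] := limit_class_transfer CM (act h (enum_of M))
  (act h (enum_of N)) Ms Ns Ms' Ns' fX.
exists (h^-1 * f' * h); first by apply: lascar_mulr; exact: lascar_mull.
move=> p pG; apply/(sat_act h); rewrite act_cat !actM actKV.
apply: fM => _ [g Gg ->]; apply/(sat_act h^-1); rewrite act_cat actK -!actM.
by apply: pG; exists (h^-1 * (g * h)) => //; rewrite mulgA -[h in _ * h]invgK; exact: normal_conj.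
Qed.

Lemma orbit_rel_act h a b : E (act h a) (act h b) -> E a b.
Proof.
move=> [f fX hab]; exists (h^-1 * f * h); first exact: jcl_conj.
by rewrite !actM -hab actK.
Qed.

(** Definability over [M] becomes closedness over the empty set because [E] is invariant: the limit
    is lifted to [(a, b, m)] with [m] a conjugate of [M], and an automorphism carries [m] back to
    [M]. *)
Lemma orbit_rel_closed a b :
  tcl [set w | exists c d, E c d /\ w = tcat c d] (tcat a b) -> E a b.
Proof.
move=> ab.
pose A : set (tup (ctx_cat (ctx_cat k k) M) C) :=
  [set w | exists2 c, @orbit_graph L C G M k (tcat c (enum_of M)) & w = tcat c (enum_of M)].
have [|||w Aw wab] := @tcl_lift _ _ _ _ CM _ _ (@sub_inl _ _ _) A _ _ _ _ _ ab.
- exact: small_cat.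
- by do !apply: small_cat.
- move=> _ [c [d [/(orbit_graphP CM GP AG Ms Ns ks) cd ->]]].
  by exists (tcat (tcat c d) (enum_of M)); [exists (tcat c d)|rewrite pull_inl].
move: Aw; rewrite (tup_cat w) wab; set m := pull _ w => Aw.
have mM : tp (pull (@sub_inr _ (ctx_cat k k) M) (tcat (tcat a b) m)) = tp (enum_of M).
  by apply: tcl_tp_const Aw => _ [c _ ->]; rewrite pull_inr.
have [h hm] := homogeneous CM (small_lt CM Ms') mM; rewrite pull_inr in hm.
apply: (@orbit_rel_act h); apply/(orbit_graphP CM GP AG Ms Ns ks).
apply: (orbit_graph_closed CM Ms ks); rewrite -hm -!act_cat.
apply: (tcl_tp (esym (tp_act h _))); apply: tcl_tcl Aw => _ [c cM ->].
exact: subset_tcl.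
Qed.

(** A formula true on [E], conjoined with its reversal, is symmetric and still true on [E], hence
    thick by [thick_over]. Thus [(a, b)] satisfies all formulas true on the closed relation [E]. *)
Lemma Theta_sub a b : Theta k a b -> E a b.
Proof.
move=> ab; apply: orbit_rel_closed => p pE.
have [E1 E2 E3] := orbit_rel_equivalence k (jcl_subgroup CM GP AG Ms Ns).
pose σ : substitution (ctx_cat k k) (ctx_cat k k) := sub_cat (@sub_inr _ _ _) (@sub_inl _ _ _).
have σE (c d : tup k C) :
    pull σ (tcat c d) = tcat d c by exact: pull_cat.
have pE' c d : E c d -> sat (And p (formula_subst p σ)) (tcat c d).
  move=> cd; apply/sat_And; split; first by apply: pE; exists c, d.
  by apply/sat_subst; rewrite σE; apply: pE; exists d, c; split=> //; exact: E2.
have /ab/sat_And[//] : thick C (And p (formula_subst p σ)).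
apply: (thick_over CM ks Ms').
  move=> c d /sat_And[cd /sat_subst]; rewrite σE => dc.
  by apply/sat_And; split=> //; apply/sat_subst; rewrite σE.
by move=> c d cd; apply: pE'; exact: (orbit_rel_over CM GP AG Ms Ns ks).
Qed.

Let R : set (tup (ctx_cat k k) C) :=
  tcl [set w | exists c d, orbit_rel k G c d /\ w = tcat c d].

Lemma limit_step a b (y : nat -> tup k C) :
  E a b -> (forall i, orbit_rel k G (y i) b) ->
  exists x' y', [/\ tp (tcat x' y') = tp (tcat a b), orbit_rel k G y' b &
    forall i, R (tcat x' (y i))].
Proof.
have [E1 E2 E3] := orbit_rel_equivalence k GP.
move=> [f + ->] yb; rewrite (jclE CM) // => fX.
pose Y : ctx L := Ctx (fun z : nat * k => csort z.2).
pose n : tup Y C := fun z => y z.1 z.2.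
have [f' ff' fn] := limit_class_transfer CM b n Ms Ns ks (small_prod_nat ks) fX.
(* Both are images of [a = f b] and [b] under [f' * f^-1], which lies in [Autf]; moreover [f' b] is
   a limit of tuples [g b] over all the [y i] at once. *)
exists (act f' b), (act (f' * f^-1) b); split.
- by rewrite -[RHS](tp_act (f' * f^-1)) act_cat !actM actK.
- exists (f' * f^-1) => //; apply: AG.
  have := lascar_mulr f^-1 ff'; rewrite mulgV /lascar invg1 mul1g.
  by [].
- move=> i.
  pose τ : substitution k Y := fun v => Var ((i, v) : Y).
  have τE : pull τ n = y i by [].
  have := @tcl_pull _ _ _ _ (sub_cat (@sub_inl _ _ _) (sub_comp τ (@sub_inr _ _ _)))
    (orb G b n) [set w | exists c d, orbit_rel k G c d /\ w = tcat c d] _ _ fn.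
  rewrite pull_cat; apply=> _ [g Gg ->]; rewrite pull_cat; apply: subset_tcl.
  exists (act g b), (y i); split=> //; apply: (E3 _ b); first by exists g.
  exact: E2.
Qed.

Lemma limit_sequence a b n : E a b -> exists x y : nat -> tup k C,
  [/\ forall i, orbit_rel k G (y i) b,
      forall i, (i < n)%N -> tp (tcat (x i) (y i)) = tp (tcat a b) &
      forall i j, (i < j)%N -> (j < n)%N -> R (tcat (x j) (y i))].
Proof.
move=> ab; elim: n => [|n [x [y [yb xy xR]]]].
  (* The sequences are total; the filler [b] lies in its own orbit. *)
  exists (fun=> b), (fun=> b); split=> // i.
  by have [E1 _ _] := orbit_rel_equivalence k GP.
have [x' [y' [xy' yb' xR']]] := limit_step ab yb.
(* The new pair comes last, so that [x'] is paired with all earlier [y i]. *)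
exists (fun i => if i == n then x' else x i), (fun i => if i == n then y' else y i).
split=> [i|i|i j ij]; first by case: eqP.
- by rewrite ltnS leq_eqVlt; case: eqP => //= _; exact: xy.
- rewrite ltnS leq_eqVlt => jn.
  have -> : (i == n) = false.
    apply/negbTE/eqP => ein; move: ij jn; rewrite ein => nj.
    by rewrite gtn_eqF // ltnNge (ltnW nj).
  by move: jn; case: eqP => //= _; exact: xR.
Qed.

Lemma orbit_rel_sub a b : E a b ->
  comp_rel (Theta k) (closure_rel (orbit_rel k G)) a b.
Proof.
move=> ab.
pose S := [set w | exists c d : tup k C, orbit_rel k G c d /\ w = tcat c d].
(* Thickness gives [i < l] with [p] true of [(x i, x l)]. The automorphism taking [(x i, y i)] to
   [(a, b)] sends [x l] to the required [c]; compactness then finds one [c] for all thick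
   formulas. *)
have thickP p : thick C p -> exists2 c, sat p (tcat a c) & R (tcat c b).
  move=> [_ [n pn]]; have [x [y [_ xy xR]]] := limit_sequence n ab.
  have [i [l [il pil]]] := pn (fun i => x i).
  have [h [hx hy]] := homogeneous2 CM ks ks (xy i (ltn_ord i)).
  exists (act h (x l)).
    by rewrite -hx -act_cat; exact/sat_act.
  rewrite -hy -act_cat; apply: tcl_tp (esym (tp_act h _)) _.
  exact: xR.
pose W := ctx_cat k (ctx_cat k k).
pose σ1 : substitution (ctx_cat k k) W := sub_cat
  (sub_comp (@sub_inl _ _ _) (@sub_inr _ _ _)) (@sub_inl _ _ _).
pose σ2 : substitution (ctx_cat k k) W := sub_cat
  (@sub_inl _ _ _) (sub_comp (@sub_inr _ _ _) (@sub_inr _ _ _)).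
have σ1E (z x y : tup k C) :
    pull σ1 (tcat z (tcat x y)) = tcat x z. by exact: pull_cat.
have σ2E (z x y : tup k C) :
    pull σ2 (tcat z (tcat x y)) = tcat z y. by exact: pull_cat.
pose P : set (formula W) := [set r | exists p q, [/\ thick C p,
  forall w, S w -> sat q w & r = And (formula_subst p σ1) (formula_subst q σ2)]].
have topP := thick_Top C k.
have [|||||w wP wab] := @compactness_over _ _ _ _ CM _ W (@sub_inr _ _ _) (tcat a b) P.
- exact: small_cat.
- by do !apply: small_cat.
- by exists (And (formula_subst (Top _) σ1) (formula_subst (Top _) σ2)), (Top _), (Top _).
- move=> _ _ [p [q [pt qS ->]]] [p' [q' [pt' qS' ->]]].
  exists (And (formula_subst (And p p') σ1) (formula_subst (And q q') σ2)).
    exists (And p p'), (And q q'); split=> //; first exact: thick_And.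
    by move=> w Sw; apply/sat_And; split; [exact: qS|exact: qS'].
  move=> w /sat_And[/sat_subst/sat_And[h1 h2] /sat_subst/sat_And[h3 h4]].
  by split; apply/sat_And; split; exact/sat_subst.
- move=> _ [p [q [/thickP[c pc Rc] qS ->]]].
  exists (tcat c (tcat a b)); last by rewrite pull_inr.
  by apply/sat_And; split; apply/sat_subst; rewrite ?σ1E ?σ2E //; exact: Rc.
move: wP; rewrite (tup_cat w) wab; set c := pull _ w => wP.
exists c; split.
- move=> p pt.
  have /wP/sat_And[/sat_subst + _] : P (And (formula_subst p σ1) (formula_subst (Top _) σ2)).
    by exists p, (Top _).
  by rewrite σ1E.
- apply/closure_relP => q qS.
  have /wP/sat_And[_ /sat_subst] : P (And (formula_subst (Top _) σ1) (formula_subst q σ2)).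
    by exists (Top _), q.
  by rewrite σ2E.
Qed.

Lemma comp_Theta_sub a b :
  comp_rel (Theta k) (closure_rel (orbit_rel k G)) a b -> E a b.
Proof.
have [_ _ Et] := orbit_rel_equivalence k (jcl_subgroup CM GP AG Ms Ns).
move=> [c [/Theta_sub ac /closure_relP cb]]; apply: (Et _ c _ ac).
apply: orbit_rel_closed; apply: tcl_sub cb => _ [c' [d' [[g Gg ->] ->]]].
exists (act g d'), d'; split=> //; exists g => //; exact: (sub_jcl CM GP AG Ms Ns).
Qed.

End Normal.

Theorem theorem2p3 (L : language) (T : set (sentence L)) (K : Type)
    (C : structure L) (M N : elem_sub C) (G : set (aut C)) :
  complete_theory T -> monster T K C ->
  small_model M -> small_model N ->
  subgroup G -> Autf C `<=` G ->
  (forall k : ctx L, small k ->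
    let E := orbit_rel k (jcl M N G) in
    [/\ equivalence E,
        bounded K E,
        exists M' : elem_sub C, small_model M' /\ type_definable_over M' E,
        rel_incl (orbit_rel k G) E
      & forall F : krel k C,
          equivalence F ->
          (exists M' : elem_sub C, small_model M' /\ type_definable_over M' F) ->
          rel_incl (orbit_rel k G) F ->
          rel_incl E F]) /\
  (normal_subgroup G ->
    forall k : ctx L, small k ->
    forall a b : tup k C,
      orbit_rel k (jcl M N G) a b <->
      comp_rel (Theta k) (closure_rel (orbit_rel k G)) a b).
Proof.
move=> _ CM Ms Ns GP AG; split=> [k ks E|GN k ks a b].
- split.
  + exact: orbit_rel_equivalence (jcl_subgroup CM GP AG Ms Ns).
  + exact: (orbit_rel_bounded CM GP AG Ms Ns ks).
  + by exists M; split=> //; exact: (orbit_rel_definable CM GP AG Ms Ns ks).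
  + by move=> a b [g Gg ->]; exists g => //; exact: (sub_jcl CM GP AG Ms Ns).
  + move=> F Fe [M' [Ms1 FM]]; exact: (orbit_rel_finest CM GP AG Ms Ns ks Fe Ms1 FM).
- split; first exact: (orbit_rel_sub CM GN AG Ms Ns ks).
  exact: (comp_Theta_sub CM GN AG Ms Ns ks).
Qed.
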